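(* Let $\alpha>1$ be a real number and let $C>1$ be such that $C\zeta(\alpha)\ge 2^\alpha$. Let $\Lambda_{C\cdot^{-\alpha}}$ be the envelope class associated with the decreasing function $f_{\alpha,C}:x\mapsto 1\wedge\frac{C}{x^\alpha}$ on $\mathbb{N}_+$. Then: 1. For every positive integer $n$, $$n^{1/\alpha}A(\alpha)\log\left\lfloor (C\zeta(\alpha))^{1/\alpha}\right\rfloor\le R^+(\Lambda_{C\cdot^{-\alpha}}^n),\qquad\text{where } A(\alpha)=\frac1\alpha\int_1^\infty\frac{1}{u^{1-1/\alpha}}\left(1-e^{-1/(\zeta(\alpha)u)}\right)\mathrm{d}u .$$ 2. As $n\to\infty$, $$R^*(\Lambda_{C\cdot^{-\alpha}}^n)\le\left(\frac{2Cn}{\alpha-1}\right)^{1/\alpha}(\log n)^{1-1/\alpha}+O(1).$$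
   Context: Logarithms are in base 2; $a\wedge b=\min(a,b)$; $\mathbb{N}_+=\{1,2,\dots\}$; $\zeta(\alpha)=\sum_{k\ge1}k^{-\alpha}$. A source on a countable alphabet $\mathcal{X}$ is a probability distribution $P$ on $\mathcal{X}^{\mathbb{N}}$; $P^n$ is the law of the first $n$ symbols and $\Lambda^n=\{P^n:P\in\Lambda\}$. The envelope class associated with $f:\mathbb{N}_+\to[0,1]$ is the collection of stationary memoryless (i.i.d.) sources $P$ on $\mathbb{N}_+$ with $P^1\{x\}\le f(x)$ for all $x\in\mathbb{N}_+$. $\mathfrak{M}_1(\mathcal{X}^n)$ is the set of probability distributions on $\mathcal{X}^n$, and $D(P^n,Q^n)=\sum_{\mathbf{x}}P^n(\mathbf{x})\log\frac{P^n(\mathbf{x})}{Q^n(\mathbf{x})}$. Minimax redundancy: $R^+(\Lambda^n)=\inf_{Q^n\in\mathfrak{M}_1(\mathcal{X}^n)}\sup_{P\in\Lambda}D(P^n,Q^n)$. Minimax regret: $R^*(\Lambda^n)=\inf_{Q^n\in\mathfrak{M}_1(\mathcal{X}^n)}\sup_{\mathbf{x}\in\mathcal{X}^n}\sup_{P\in\Lambda}\log\frac{P^n(\mathbf{x})}{Q^n(\mathbf{x})}$, with the conventions $0/0=0$, $\log0=-\infty$, $\log(a/0)=+\infty$ for $a>0$. *)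

(* Defs.v *)
From HB Require Import structures.
From mathcomp Require Import all_boot all_order all_algebra.
From mathcomp Require Import all_classical all_reals all_analysis.

Set Implicit Arguments.
Unset Strict Implicit.
Unset Printing Implicit Defensive.
Import Order.TTheory GRing.Theory Num.Theory.
Import numFieldNormedType.Exports.
Local Open Scope classical_set_scope.
Local Open Scope ring_scope.

Definition Npos : Type := {k : nat | (0 < k)%N}.
HB.instance Definition _ := Countable.on Npos.
HB.instance Definition _ :=
  isPointed.Build Npos (exist (fun k => (0 < k)%N) 1%N isT).

(* Infinite words over Npos, with the product sigma-algebra: as Npos is
   countable, it is generated by the events "the i-th symbol is a". *)
Definition symbol_events : set (set (nat -> Npos)) :=
  [set E | exists i a, E = [set w | w i = a]].

Section Sources.
Context {R : realType}.

Definition source := probability (g_sigma_algebraType symbol_events) R.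

(* The probability mass function of the first n symbols. *)
Definition law (P : source) (n : nat) (x : n.-tuple Npos) : R :=
  fine (P [set w : nat -> Npos | forall i : 'I_n, w i = tnth x i]).

Definition laws (L : set source) (n : nat) : set (n.-tuple Npos -> R) :=
  [set @law P n | P in L].

Definition marginal (P : source) (a : Npos) : R := law P [tuple a].

Definition stationary_memoryless (P : source) : Prop :=
  forall (n : nat) (x : n.-tuple Npos),
    law P x = \prod_(i < n) marginal P (tnth x i).

Definition envelope_class (f : Npos -> R) : set source :=
  [set P | stationary_memoryless P /\ forall a, marginal P a <= f a].

End Sources.
Arguments source R : clear implicits.
Arguments laws {R} L n.

Section Minimax.
Context {R : realType}.

Definition log2 (x : R) : R := ln x / ln 2.

(* Base-2 logarithm of p / q. In \bar R, lne 0 = -oo, 0 / 0 = 0 * +oo = 0 and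
   a / 0 = +oo for a > 0. *)
Definition log2_ratio (p q : R) : \bar R :=
  (lne (p%:E / q%:E) * (ln 2)^-1%:E)%E.

Context {T : choiceType}.

Definition pmf : set (T -> R) :=
  [set q | (forall x, 0 <= q x) /\ \esum_(x in [set: T]) (q x)%:E = 1%E].

(* Terms with p x = 0 vanish, since 0 * -oo = 0 in \bar R. The series has terms
   of both signs, whereas esum is meant for nonnegative families; when p and q
   are mass functions the negative part is summable, so no +oo - +oo arises. *)
Definition kl_div (p q : T -> R) : \bar R :=
  let t := fun x => ((p x)%:E * log2_ratio (p x) (q x))%E in
  (\esum_(x in [set: T]) t^\+ x - \esum_(x in [set: T]) t^\- x)%E.

Definition minimax_redundancy (G : set (T -> R)) : \bar R :=
  ereal_inf [set ereal_sup [set kl_div p q | p in G] | q in pmf].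

Definition minimax_regret (G : set (T -> R)) : \bar R :=
  ereal_inf [set ereal_sup [set ereal_sup [set log2_ratio (p x) (q x) | p in G]
                           | x in [set: T]]
            | q in pmf].

End Minimax.

Section PowerLaw.
Context {R : realType}.

(* Meaningful for a > 1, where the series converges. *)
Definition zeta (a : R) : R :=
  limn (series (fun k : nat => (k.+1%:R `^ a)^-1)).

Definition power_envelope (a C : R) (x : Npos) : R :=
  Num.min 1 (C / (sval x)%:R `^ a).

Definition redundancy_constant (a : R) : \bar R :=
  (a^-1%:E * \int[lebesgue_measure]_(u in `[1%R, +oo[)
     ((u `^ (1 - a^-1))^-1 * (1 - expR (- (zeta a * u)^-1)))%:E)%E.

End PowerLaw.

(* Main.v *)
Require Import Defs.
From HB Require Import structures.
From mathcomp Require Import all_boot all_order all_algebra.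
From mathcomp Require Import all_classical all_reals all_analysis.
From mathcomp Require Import measurable_realfun ring lra.

Import Order.TTheory GRing.Theory Num.Theory.
Import numFieldNormedType.Exports.
Local Open Scope classical_set_scope.
Local Open Scope ring_scope.

(** Lower bound. Put [m := floor ((C * zeta alpha) `^ alpha^-1)] and cut the
    letters into blocks of length [m]. A selector [th] picks one letter in each
    block, and the memoryless source of [th] gives mass
    [p k = 1 / (zeta alpha * (k + 1) `^ alpha)] to the letter picked in block
    [k]; the choice of [m] is exactly what places it in the envelope class. The
    redundancy is at least the mutual information between a uniformly drawn
    selector and the output ([minimax_redundancy_ge_information]). The output
    reveals [th] exactly on the blocks that it visits, so this information is
    [log2 m] times the expected number of visited blocks
    ([redundancy_ge_blocks]), namely [\sum_k (1 - (1 - p k) ^+ n)]. As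
    [(1 - p k) ^+ n <= expR (- n * p k)], comparing the sum with the integral
    after the substitution [u = x `^ alpha / n] gives the constant
    ([redundancy_constant_le]). The sources themselves, probabilities on infinite
    words, are obtained by arithmetic coding: a uniform number of [0, 1) is
    decoded into a word, and the numbers whose word has a given prefix form an
    interval whose length is the probability of the prefix
    ([iid_source_exists]).

    Upper bound. The regret is [O(n `^ alpha^-1)] ([power_regret_le]), which
    is below the announced bound for large [n] because
    [log n `^ (1 - alpha^-1)] tends to infinity; the additive constant can be
    taken to be 0. To bound the regret it suffices to dominate all the
    probabilities of a word by one summable function. Writing [lam a = n * P a],
    the probability of a word with letter counts [k a] is
    [n ^- n * \prod_a lam a ^+ k a], and each factor is a Poisson weight up to
    [k a `! * expR (lam a)]; since [lam a <= L a := n * f a], a Poisson weight is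
    at most a geometric weight whose total mass is [1 + expR 1 * L a]
    ([poisson_le_letter_weight]). The sum over all words of the products
    [\prod_a k a `! * weight a (k a)] is at most [n`!] times the product of the
    total masses ([sum_words_le]). Hence, for any envelope [f], the regret is at
    most [log2 (expR 1 * n) + \sum_a log2 (1 + expR 1 * n * f a)]
    ([envelope_regret_le]), and for the power law this sum is
    [O(n `^ alpha^-1)] ([prod_power_le]). *)

(** * Words with given letter counts *)

Lemma big_tupleS (V : Type) (idx : V) (op : Monoid.com_law idx) (I : finType)
    (n : nat) (F : n.+1.-tuple I -> V) :
  \big[op/idx]_(x : n.+1.-tuple I) F x =
  \big[op/idx]_(i : I) \big[op/idx]_(y : n.-tuple I) F [tuple of i :: y].
Proof.
rewrite pair_big /=.
rewrite (reindex (fun p : I * n.-tuple I => [tuple of p.1 :: p.2])) //=.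
exists (fun x : n.+1.-tuple I => (thead x, [tuple of behead x])).
  by move=> [i y] _ /=; congr pair; apply/val_inj.
by move=> x _; rewrite /= -tuple_eta.
Qed.

Lemma sum_tuple_prod (R : comNzSemiRingType) (I : finType) (n : nat)
    (g : I -> R) :
  \sum_(x : n.-tuple I) \prod_(t < n) g (tnth x t) = (\sum_i g i) ^+ n.
Proof.
elim: n => [|n IH].
  rewrite (big_pred1 [tuple]) ?big_ord0 ?expr0 // => x.
  by apply/esym/eqP; rewrite tuple0.
rewrite big_tupleS exprS mulr_suml; apply: eq_bigr => i _.
rewrite -IH mulr_sumr; apply: eq_bigr => y _.
rewrite big_ord_recl tnth0; congr *%R; apply: eq_bigr => t _.
by rewrite tnthS.
Qed.

Lemma sum_count_mem (I : finType) (s : seq I) :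
  (\sum_i count_mem i s = size s)%N.
Proof.
elim: s => [|x s IH] /=; first by rewrite big1.
rewrite big_split /= IH (bigD1 x) //= eqxx big1 => [|i /negPf]; first by [].
by rewrite eq_sym => ->.
Qed.

(** Choosing the first letter [i] of a word with letter counts [c] leaves a
    word with [c i] lowered by one, so the claim follows from
    [(\sum_i c i) * n`! = n.+1`!]. *)
Lemma card_words_le (I : finType) (n : nat) (c : I -> nat) :
  ((\sum_(x : n.-tuple I) [forall i, count_mem i x == c i]) *
     \prod_i (c i)`! <= n`!)%N.
Proof.
elim: n c => [|n IH] c.
  rewrite (big_pred1 [tuple]) => [|x]; last first.
    by apply/esym/eqP; rewrite tuple0.
  case: forallP => // cE; rewrite mul1n big1 // => i _.
  by have /eqP/= <- := cE i.
have [sum_c|sum_c] := eqVneq (\sum_i c i)%N n.+1; last first.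
  rewrite big1 ?mul0n // => x _; case: forallP => // cE.
  case/eqP: sum_c; rewrite -[RHS](size_tuple x) -sum_count_mem.
  by apply: eq_bigr => i _; have /eqP <- := cE i.
rewrite big_tupleS factS -[X in (_ <= X * _)%N]sum_c !big_distrl /=; apply: leq_sum => i _.
have [ci0|ci_gt0] := posnP (c i).
  rewrite big1 ?mul0n // => y _; case: forallP => // cE.
  by have := cE i; rewrite ci0 /= eqxx.
pose c' j := (c j - (i == j))%N.
have fact_c : (\prod_j (c j)`! = c i * \prod_j (c' j)`!)%N.
  rewrite (bigD1 i) //= [X in (_ = _ * X)%N](bigD1 i) //= /c' eqxx subn1.
  rewrite mulnA; congr muln; first by case: (c i) ci_gt0.
  by apply: eq_bigr => j /negPf; rewrite eq_sym => ->; rewrite subn0.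
rewrite fact_c mulnCA leq_mul2l; apply/orP; right.
apply: leq_trans (IH c'); rewrite leq_mul2r; apply/orP; right.
apply: leq_sum => y _; case: forallP => // cE.
suff -> : [forall j, count_mem j y == c' j] by [].
by apply/forallP => j; rewrite /c' -(eqP (cE j)) /= addKn.
Qed.

(** Grouping words by their letter counts turns the sum into a sum over count
    vectors; a vector [c] accounts for at most [n`! / \prod_i (c i)`!] words,
    which cancels the factorials. *)
Lemma sum_words_le (R : realFieldType) (I : finType) (n : nat)
    (w : I -> nat -> R) : (forall i k, 0 <= w i k) ->
  \sum_(x : n.-tuple I) \prod_i ((count_mem i x)`!%:R * w i (count_mem i x))
    <= n`!%:R * \prod_i \sum_(k < n.+1) w i k.
Proof.
move=> w_ge0.
pose cnt (x : n.-tuple I) : {ffun I -> 'I_n.+1} :=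
  [ffun i => inord (count_mem i x)].
have cntE x i : cnt x i = count_mem i x :> nat.
  by rewrite ffunE inordK // ltnS -[leqRHS](size_tuple x) count_size.
rewrite (partition_big cnt predT) //= bigA_distr_bigA /= mulr_sumr.
apply: ler_sum => c _.
rewrite (eq_bigr (fun=> \prod_i (c i)`!%:R * \prod_i w i (c i))); last first.
  move=> x /eqP <-; rewrite -big_split /=.
  by apply: eq_bigr => i _; rewrite cntE.
rewrite -mulr_suml ler_wpM2r ?prodr_ge0 //.
rewrite -natr_prod sumr_const -[leLHS]mulr_natr -natrM ler_nat mulnC.
apply: leq_trans (card_words_le _ n (fun i => c i)); rewrite leq_mul2r.
apply/orP; right; rewrite -sum1_card big_mkcond; apply: leq_sum => x _ /=.
case: ifP => // xc; have <- : cnt x = c by apply/eqP; exact: xc.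
by case: forallP => // -[] i; rewrite cntE.
Qed.

(** * Laws of sources and sums over words *)

Lemma measurable_cylinder (n : nat) (x : n.-tuple Npos) :
  measurable ([set w : nat -> Npos | forall i : 'I_n, w i = tnth x i]
    : set (g_sigma_algebraType symbol_events)).
Proof.
rewrite (_ : [set _ | _] =
    \bigcap_(i in [set: 'I_n]) [set w : nat -> Npos | w i = tnth x i]).
  apply: fin_bigcap_measurable => // i _.
  by apply: sub_sigma_algebra; exists i, (tnth x i).
by apply/seteqP; split=> w /= wx i; [move=> _|]; exact: wx.
Qed.

Lemma law_ge0 (R : realType) (P : source R) n (x : n.-tuple Npos) :
  0 <= law P x.
Proof. by rewrite fine_ge0. Qed.

Lemma marginal_sum_le1 (R : realType) (P : source R) (s : seq Npos) :
  uniq s -> \sum_(a <- s) marginal P a <= 1.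
Proof.
move=> uniq_s.
pose E (a : Npos) := [set w : nat -> Npos | forall i : 'I_1, w i = tnth [tuple a] i].
have mE a : measurable (E a : set (g_sigma_algebraType symbol_events)).
  exact: measurable_cylinder.
have fin_s : finite_set [set` s] by exact: finite_seq.
have trivE : trivIset [set` s] E.
  move=> a b _ _ [w [/(_ ord0) + /(_ ord0)]].
  by rewrite !tnth0 => <- <-.
rewrite -lee_fin; have : (\sum_(a <- s) P (E a) <= 1)%E.
  rewrite fsbig_seq // -(measure_fin_bigcup P fin_s trivE) //.
  by apply: probability_le1; apply: fin_bigcup_measurable.
apply: le_trans; rewrite -sumEFin; apply: lee_sum => a _.
by rewrite /marginal /law fineK //; apply: fin_num_measure; exact: mE.
Qed.

Section ESum.
Context {R : realType} {T : choiceType}.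
Implicit Type a : T -> R.

Lemma esum_le_seq a (B : R) :
  (forall s, uniq s -> \sum_(x <- s) a x <= B) ->
  (\esum_(x in [set: T]) (a x)%:E <= B%:E)%E.
Proof.
move=> le_B; apply: ge_ereal_sup => _ [X [finX _] <-].
by rewrite fsbig_finite // sumEFin lee_fin le_B // finmap.fset_uniq.
Qed.

Lemma le_seq_esum a (s : seq T) : uniq s ->
  ((\sum_(x <- s) a x)%:E <= \esum_(x in [set: T]) (a x)%:E)%E.
Proof.
move=> uniq_s; apply: esum_ge; exists [set` s]; first by split.
by rewrite -fsbig_seq // sumEFin.
Qed.

Lemma le_sum_esum (I : finType) (h : I -> T) a : injective h ->
  ((\sum_i a (h i))%:E <= \esum_(x in [set: T]) (a x)%:E)%E.
Proof.
move=> h_inj; rewrite -(big_map h xpredT a) le_seq_esum //.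
by rewrite map_inj_uniq // index_enum_uniq.
Qed.

End ESum.

(** The letters are numbered from 0, so that the first [M] letters are indexed
    by ['I_M]. *)
Definition letter (k : nat) : Npos := exist (fun k => (0 < k)%N) k.+1 isT.

Lemma letter_inj : injective letter.
Proof. by move=> j k [->]. Qed.

Lemma letterK (a : Npos) : letter (sval a).-1 = a.
Proof. by apply/val_inj => /=; rewrite prednK //; case: a. Qed.

Definition word (M n : nat) (y : n.-tuple 'I_M) : n.-tuple Npos :=
  map_tuple (fun j : 'I_M => letter j) y.

Lemma word_surj (n : nat) (s : seq (n.-tuple Npos)) :
  exists M, forall x, x \in s -> exists y : n.-tuple 'I_M, x = word M n y.
Proof.
pose N := (\max_(x <- s) \max_(a <- x) sval a)%N.
exists N.+1 => x xs.
pose y := [tuple inord (sval (tnth x t)).-1 | t < n] : n.-tuple 'I_N.+1.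
exists y; apply: eq_from_tnth => t; rewrite tnth_map tnth_mktuple inordK.
  by rewrite letterK.
rewrite ltnS; apply: leq_trans (leq_pred _) _.
have := @leq_bigmax_seq _ s xpredT
  (fun x : n.-tuple Npos => \max_(a <- x) sval a)%N x xs isT.
apply: leq_trans.
exact: (@leq_bigmax_seq _ x xpredT (fun a => sval a) _ (mem_tnth t x) isT).
Qed.

(** A finite set of words uses only finitely many letters. *)
Lemma esum_words_le (R : realType) (n : nat) (g : n.-tuple Npos -> R) (B : R) :
  (forall x, 0 <= g x) ->
  (forall M, \sum_(y : n.-tuple 'I_M) g (word M n y) <= B) ->
  (\esum_(x in [set: n.-tuple Npos]) (g x)%:E <= B%:E)%E.
Proof.
move=> g_ge0 le_B; apply: esum_le_seq => s uniq_s.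
have [M sM] := word_surj n s; apply: le_trans (le_B M).
rewrite [leRHS](_ : _ = \sum_(x <- map (word M n) (index_enum _)) g x); last first.
  by rewrite big_map.
have word_inj : injective (word M n).
  move=> y z yz; apply: eq_from_tnth => t; apply/val_inj/letter_inj.
  by have := congr1 (fun x => tnth x t) yz; rewrite !tnth_map.
pose t := map (word M n) (index_enum _).
have uniq_t : uniq t by rewrite map_inj_uniq // index_enum_uniq.
have s_t : perm_eq s [seq x <- t | x \in s].
  apply: uniq_perm => //; first by rewrite filter_uniq.
  move=> x; rewrite mem_filter; case: (boolP (x \in s)) => //= xs.
  by have [y ->] := sM x xs; rewrite map_f // mem_index_enum.
by rewrite (perm_big _ s_t) /= big_filter big_mkcond /=; apply: ler_sum => x _; case: ifP.
Qed.

(** * A universal code for an envelope class *)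

Lemma esumZl (R : realType) (T : choiceType) (c : R) (a : T -> R) : 0 < c ->
  (\esum_(x in [set: T]) (c * a x)%:E =
   c%:E * \esum_(x in [set: T]) (a x)%:E)%E.
Proof.
move=> c_gt0; apply/eqP; rewrite eq_le; apply/andP; split.
  apply: ge_ereal_sup => _ [X [finX _] <-].
  rewrite fsbig_finite // sumEFin -mulr_sumr EFinM lee_pmul2l //.
  by rewrite le_seq_esum // finmap.fset_uniq.
rewrite -lee_pdivlMl //; apply: ge_ereal_sup => _ [X [finX _] <-].
rewrite fsbig_finite // sumEFin lee_pdivlMl // -EFinM mulr_sumr.
by rewrite (le_seq_esum (fun x => c * a x)) // finmap.fset_uniq.
Qed.

(** The code is [g] normalized: dividing [g] by a sum that is at most [B] worsens
    the ratio [p / g <= A] by at most [B]. *)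
Lemma minimax_regret_le (R : realType) (T : choiceType) (G : set (T -> R))
    (g : T -> R) (A B : R) (x0 : T) :
  0 < A -> (forall x, 0 < g x) -> (\esum_(x in [set: T]) (g x)%:E <= B%:E)%E ->
  (forall p x, G p -> 0 <= p x <= A * g x) ->
  (minimax_regret G <= (log2 (A * B))%:E)%E.
Proof.
move=> A_gt0 g_gt0 g_sum G_le.
have g_ge0 x : 0 <= g x by exact/ltW/g_gt0.
have sum_gt0 : (0 < \esum_(x in [set: T]) (g x)%:E)%E.
  apply: lt_le_trans (le_seq_esum g [:: x0] isT).
  by rewrite big_seq1 lte_fin.
set S := (\esum_(x in _) _)%E in g_sum sum_gt0.
have S_fin : S \is a fin_num.
  by rewrite ge0_fin_numE ?ltW // (le_lt_trans g_sum) // ltry.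
pose s := fine S; have SE : S = s%:E by rewrite fineK.
have s_gt0 : 0 < s by rewrite -lte_fin -SE.
have s_le : s <= B by rewrite -lee_fin -SE.
have AB_gt0 : 0 < A * B by rewrite mulr_gt0 // (lt_le_trans s_gt0).
have ln2_gt0 : 0 < ln (2 : R) by rewrite ln_gt0 // ltr1n.
pose q x := g x / s.
apply: ge_ereal_inf; eexists.
  exists q; last reflexivity.
  split=> [x|]; first by rewrite divr_ge0 // ltW.
  rewrite /q; under eq_esum do rewrite mulrC.
  by rewrite esumZl ?invr_gt0 // -/S SE -EFinM mulVf ?gt_eqF.
apply: ge_ereal_sup => _ [x _ <-]; apply: ge_ereal_sup => _ [p Gp <-].
have /andP[p_ge0 p_le] := G_le p x Gp.
have q_gt0 : 0 < q x by rewrite divr_gt0.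
rewrite /log2_ratio inver gt_eqF // -EFinM.
have [p0|p_neq0] := eqVneq (p x) 0.
  by rewrite p0 mul0r le0_lneNy // gt0_mulNye ?leNye // lte_fin invr_gt0.
have p_gt0 : 0 < p x by rewrite lt_neqAle eq_sym p_neq0.
rewrite lne_EFin ?divr_gt0 // -EFinM lee_fin ler_pM2r ?invr_gt0 //.
rewrite ler_ln ?posrE ?divr_gt0 // ler_pdivrMr //.
apply: le_trans p_le _; rewrite -mulrA ler_pM2l // mulrC.
by rewrite /q mulrAC ler_pdivlMr // ler_pM2l.
Qed.

Section EnvelopeMixture.
Context {R : realType}.

(** The weight of a letter repeated [k] times, for a letter that is expected
    [L] times. It bounds the Poisson weights [expR (- lam) * lam ^+ k / k`!]
    of all intensities [lam <= L], its total is at most [1 + expR 1 * L], and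
    absent letters weigh 1. *)
Definition letter_weight (L : R) (k : nat) : R :=
  if k is 0%N then 1 else expR 1 * (L / (1 + L)) ^+ k.

Lemma letter_weight_gt0 (L : R) k : 0 < L -> 0 < letter_weight L k.
Proof.
move=> L_gt0; case: k => //= k; rewrite mulr_gt0 ?expR_gt0 // exprn_gt0 //.
by rewrite divr_gt0 // addr_gt0.
Qed.

(** Tilting: with [s = (1 + L) / L], the exponential series at [s * lam]
    gives [(s * lam) ^+ k / k`! <= expR (s * lam) <= expR (lam + 1)]. *)
Lemma poisson_le_letter_weight (L lam : R) k : 0 < L -> 0 <= lam <= L ->
  lam ^+ k <= k`!%:R * expR lam * letter_weight L k.
Proof.
move=> L_gt0 /andP[lam_ge0 lam_le].
case: k => [|k] /=.
  by rewrite fact0 mul1r mulr1 expr0 (le_trans _ (expR_ge1Dx _)) // lerDl.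
pose s := (1 + L) / L.
have s_gt0 : 0 < s by rewrite divr_gt0 // addr_gt0.
have slam_le : s * lam <= lam + 1.
  have -> : s * lam = lam + lam / L.
    by rewrite /s; field; rewrite gt_eqF.
  by rewrite lerD2l ler_pdivrMr // mul1r.
have slam_ge0 : 0 <= s * lam by rewrite mulr_ge0 // ltW.
have : (s * lam) ^+ k.+1 / k.+1`!%:R <= expR lam * expR 1.
  rewrite -expRD; apply: le_trans (_ : expR (s * lam) <= _); last first.
    by rewrite ler_expR.
  by apply: le_trans (@expR_ge1Dxn R (s * lam) k slam_ge0); rewrite lerDr.
rewrite ler_pdivrMr ?ltr0n ?fact_gt0 // exprMn => exp_le.
have -> : L / (1 + L) = s^-1 by rewrite /s invf_div.
rewrite exprVn mulrA ler_pdivlMr ?exprn_gt0 //.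
by rewrite [leLHS]mulrC -mulrA [leRHS]mulrC.
Qed.

Lemma sum_letter_weight_le (L : R) n : 0 < L ->
  \sum_(k < n.+1) letter_weight L k <= 1 + expR 1 * L.
Proof.
move=> L_gt0; rewrite big_ord_recl /= lerD2l -mulr_sumr.
rewrite ler_wpM2l ?expR_ge0 //.
have L1_neq0 : 1 + L != 0 by rewrite gt_eqF // addr_gt0.
have -> : \sum_(i < n) (L / (1 + L)) ^+ bump 0 i = L * (1 - (L / (1 + L)) ^+ n).
  elim: n => [|n IH]; first by rewrite big_ord0 expr0 subrr mulr0.
  rewrite big_ord_recr /= IH /bump leq0n add1n exprS.
  by set r := _ ^+ n; field.
apply: ler_piMr; first exact: ltW.
by rewrite gerBl exprn_ge0 // divr_ge0 // ltW // addr_gt0.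
Qed.

Lemma prod_count (I : finType) (s : seq I) (g : I -> R) :
  \prod_(x <- s) g x = \prod_i g i ^+ count_mem i s.
Proof.
elim: s => [|x s IH]; first by rewrite big_nil big1.
rewrite big_cons IH /= [in RHS](bigD1 x) //= eqxx add1n exprS -mulrA.
congr *%R; rewrite [LHS](bigD1 x) //=; congr *%R.
by apply: eq_bigr => i /negPf; rewrite eq_sym => ->.
Qed.

Variables (f : Npos -> R) (n : nat).
Hypothesis f_gt0 : forall a, 0 < f a.

(** A universal code for the envelope class of [f], before normalization.
    Absent letters weigh 1, so the product may be taken over any finite set
    that contains the letters of the word. *)
Definition envelope_mixture (x : n.-tuple Npos) : R :=
  \prod_(a <- undup x)
    ((count_mem a x)`!%:R * letter_weight (n%:R * f a) (count_mem a x)).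

Lemma envelope_mixture_gt0 x : (0 < n)%N -> 0 < envelope_mixture x.
Proof.
move=> n_gt0; apply/prodr_gt0 => a _; rewrite mulr_gt0 ?ltr0n ?fact_gt0 //.
by rewrite letter_weight_gt0 // mulr_gt0 // ltr0n.
Qed.

Lemma envelope_mixture_word M (y : n.-tuple 'I_M) :
  envelope_mixture (word M n y) =
  \prod_j ((count_mem j y)`!%:R *
           letter_weight (n%:R * f (letter j)) (count_mem j y)).
Proof.
have lin : injective (fun j : 'I_M => letter j).
  by move=> j k /letter_inj/val_inj.
rewrite /envelope_mixture [undup _](_ : _ = map letter (map val (undup y))); last first.
  by rewrite -map_comp /= undup_map_inj.
rewrite !big_map [RHS](bigID (mem y)) /= [X in _ = _ * X]big1 ?mulr1; last first.
  move=> j /negbTE jy; have -> : count_mem j y = 0%N.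
    by apply/count_memPn; rewrite jy.
  by rewrite fact0 mul1r.
rewrite [RHS](eq_bigl (mem (undup y))) => [|j]; last by rewrite /= mem_undup.
rewrite big_uniq ?undup_uniq //=; apply: eq_bigr => j _.
rewrite count_map; congr (_`!%:R * letter_weight _ _);
  by apply: eq_count => k /=; rewrite (inj_eq lin).
Qed.

End EnvelopeMixture.

Section EnvelopeRegret.
Context {R : realType}.
Variables (f : Npos -> R) (n : nat).
Hypotheses (f_gt0 : forall a, 0 < f a) (n_gt0 : (0 < n)%N).

Let nR_gt0 : 0 < n%:R :> R. Proof. by rewrite ltr0n. Qed.

(** With [lam a = n * p a], the probability of a word is [n ^- n] times the
    product of [lam a ^+ count a], and [\sum_a lam a <= n], so that the factors
    [expR (lam a)] lost in the Poisson bound cost at most [expR n] together. *)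
Lemma law_le_envelope_mixture (P : source R) (x : n.-tuple Npos) :
  envelope_class f P -> law P x <= expR n%:R / n%:R ^+ n * envelope_mixture f n x.
Proof.
move=> [iid_P P_le].
have [M /(_ x)] := word_surj n [:: x].
rewrite inE => /(_ (eqxx _)) [y ->{x}].
rewrite iid_P mulrAC ler_pdivlMr ?exprn_gt0 // envelope_mixture_word.
pose p (j : 'I_M) := marginal P (letter j).
have -> : \prod_(t < n) marginal P (tnth (word M n y) t) = \prod_(j <- y) p j.
  by rewrite big_tuple; apply: eq_bigr => t _; rewrite tnth_map.
have -> : \prod_(j <- y) p j * n%:R ^+ n = \prod_(j <- y) (n%:R * p j).
  by rewrite big_split /= big_const_seq count_predT size_tuple iter_mulr_1 mulrC.
have p_ge0 j : 0 <= p j by exact: law_ge0.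
apply: le_trans (_ : \prod_j ((count_mem j y)`!%:R * expR (n%:R * p j) *
    letter_weight (n%:R * f (letter j)) (count_mem j y)) <= _).
  rewrite [leLHS]prod_count; apply: ler_prod => j _.
  rewrite exprn_ge0 ?mulr_ge0 //= poisson_le_letter_weight ?mulr_gt0 //.
  by rewrite mulr_ge0 //= ler_pM2l // P_le.
under eq_bigr do rewrite mulrAC mulrC.
rewrite big_split /= -expR_sum -mulr_sumr ler_wpM2r //.
  apply: prodr_ge0 => j _.
  by rewrite mulr_ge0 // ltW // letter_weight_gt0 // mulr_gt0.
rewrite ler_expR ler_piMr // /p.
rewrite -(big_map (fun j : 'I_M => letter j) xpredT (marginal P)).
apply: marginal_sum_le1; rewrite map_inj_uniq ?index_enum_uniq //.
by move=> j k /letter_inj/val_inj.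
Qed.

(** By induction on [k], from [(k / k.+1) ^+ k.+1 <= expR (-1)]. *)
Lemma fact_le_expR (k : nat) : (0 < k)%N ->
  k`!%:R * expR k%:R <= expR 1 * k%:R * k%:R ^+ k :> R.
Proof.
elim: k => // -[|k] IH _; first by rewrite factS fact0 muln1 expr1 mul1r !mulr1.
set m := k.+1 in IH *.
have m_gt0 : 0 < m%:R :> R by rewrite ltr0n.
have m1_gt0 : 0 < m.+1%:R :> R by rewrite ltr0n.
have step : m%:R ^+ m.+1 * expR 1 <= m.+1%:R ^+ m.+1 :> R.
  have := @expR_ge1Dx R (- m.+1%:R^-1).
  have -> : 1 - m.+1%:R^-1 = m%:R / m.+1%:R :> R.
    by rewrite -[m.+1]addn1 natrD; field; rewrite -natr1 gt_eqF.
  have mm_ge0 : 0 <= m%:R / m.+1%:R :> R by rewrite divr_ge0.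
  move=> /(lerXn2r m.+1) ; rewrite !nnegrE mm_ge0 expR_ge0 => /(_ isT isT).
  rewrite -expRM_natl mulrN divff ?gt_eqF // expr_div_n ler_pdivrMr ?exprn_gt0 //.
  by rewrite expRN ler_pdivlMl ?expR_gt0 // mulrC.
rewrite factS natrM -[X in expR X%:R]addn1 natrD expRD.
rewrite (_ : _ * _ = m.+1%:R * (m`!%:R * expR m%:R) * expR 1); last by ring.
apply: le_trans (_ : m.+1%:R * (expR 1 * m%:R * m%:R ^+ m) * expR 1 <= _).
  by rewrite ler_wpM2r ?expR_ge0 // ler_wpM2l // IH.
rewrite (_ : _ * expR 1 = expR 1 * m.+1%:R * (m%:R ^+ m.+1 * expR 1)); last first.
  by rewrite exprS; ring.
by rewrite ler_wpM2l // mulr_ge0 ?expR_ge0.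
Qed.

Lemma sum_envelope_mixture_le M :
  \sum_(y : n.-tuple 'I_M) envelope_mixture f n (word M n y) <=
  n`!%:R * \prod_(j < M) (1 + expR 1 * (n%:R * f (letter j))).
Proof.
have L_gt0 (j : 'I_M) : 0 < n%:R * f (letter j) by rewrite mulr_gt0.
pose w (j : 'I_M) := letter_weight (n%:R * f (letter j)).
have w_ge0 j k : 0 <= w j k by rewrite ltW // letter_weight_gt0.
under eq_bigr do rewrite envelope_mixture_word.
apply: le_trans (@sum_words_le _ _ n w w_ge0) _.
rewrite ler_wpM2l //; apply: ler_prod => j _.
by rewrite sumr_ge0 //= sum_letter_weight_le.
Qed.

Lemma envelope_regret_le (B : R) :
  (forall M, \prod_(j < M) (1 + expR 1 * (n%:R * f (letter j))) <= B) ->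
  (minimax_regret (laws (envelope_class f) n)
     <= (log2 (expR 1 * n%:R * B))%:E)%E.
Proof.
move=> prod_le.
have B_gt0 : 0 < B by apply: lt_le_trans (prod_le 0%N); rewrite big_ord0.
have -> : expR 1 * n%:R * B =
    (expR 1 * n%:R * n%:R ^+ n / n`!%:R / n%:R ^+ n) * (n`!%:R * B).
  by field; rewrite !gt_eqF ?exprn_gt0 // ltr0n fact_gt0.
apply: (@minimax_regret_le _ _ _ (envelope_mixture f n) _ _ [tuple of nseq n (letter 0)]).
- by rewrite !mulr_gt0 ?invr_gt0 ?exprn_gt0 ?expR_gt0 // ltr0n fact_gt0.
- by move=> x; exact: envelope_mixture_gt0.
- apply: esum_words_le => [x|M]; first by rewrite ltW // envelope_mixture_gt0.
  apply: le_trans (sum_envelope_mixture_le M) _.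
  by rewrite ler_wpM2l // prod_le.
move=> _ x [P f_P <-]; rewrite law_ge0 /=.
apply: le_trans (law_le_envelope_mixture P x f_P) _.
rewrite ler_wpM2r //; first by rewrite ltW // envelope_mixture_gt0.
rewrite ler_wpM2r ?invr_ge0 ?exprn_ge0 // ler_pdivlMr ?ltr0n ?fact_gt0 //.
by rewrite mulrC fact_le_expR.
Qed.

End EnvelopeRegret.

(** * Regret of power-law envelopes *)

Lemma powR_div (R : realType) (x y a : R) : 0 <= x -> 0 <= y ->
  (x / y) `^ a = x `^ a / y `^ a.
Proof.
move=> x_ge0 y_ge0; rewrite powRM ?invr_ge0 // -powR_inv1 // -powRrM mulN1r.
by rewrite powRN.
Qed.

Section PowerSums.
Context {R : realType}.
Variable alpha : R.
Hypothesis alpha_gt1 : 1 < alpha.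

(** The telescoping form of the integral comparison for
    [(x + 1) `^ (- alpha)]; the Bernoulli-type inequality behind it is
    [expR (b / (x + 1)) >= 1 + b / (x + 1)] with [b = alpha - 1]. *)
Lemma powR_telescope (x : R) : 0 < x ->
  (x + 1) `^ (- alpha) <= (x `^ (1 - alpha) - (x + 1) `^ (1 - alpha)) / (alpha - 1).
Proof.
move=> x_gt0; set b := alpha - 1.
have b_gt0 : 0 < b by rewrite subr_gt0.
have x1_gt0 : 0 < x + 1 by rewrite addr_gt0.
rewrite ler_pdivlMr // lerBrDr.
have -> : (x + 1) `^ (- alpha) = (x + 1) `^ (1 - alpha) / (x + 1).
  rewrite [in LHS](_ : - alpha = 1 - alpha - 1); last by ring.
  by rewrite [LHS]powRB ?powRr1 ?ltW // (gt_eqF x1_gt0) implybT.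
have -> : (x + 1) `^ (1 - alpha) / (x + 1) * b + (x + 1) `^ (1 - alpha) =
    (x + 1) `^ (1 - alpha) * (1 + b / (x + 1)) by ring.
have -> : x `^ (1 - alpha) = (x + 1) `^ (1 - alpha) * (x / (x + 1)) `^ (1 - alpha).
  rewrite -powRM ?ltW ?divr_gt0 //; congr (_ `^ _).
  by field; rewrite gt_eqF.
rewrite ler_pM2l ?powR_gt0 // /powR gt_eqF ?divr_gt0 //.
apply: le_trans (expR_ge1Dx _) _; rewrite ler_expR.
have -> : 1 - alpha = - b by rewrite /b; ring.
rewrite mulNr -mulrN ler_pM2l // lerNr.
have -> : x / (x + 1) = 1 + - (x + 1)^-1 by field; rewrite gt_eqF.
apply: le_ln1Dx; rewrite ltrNl opprK invf_lt1 // ltrDr //.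
Qed.

Lemma sum_powR_tail_le (m M : nat) : (0 < m)%N ->
  \sum_(j < M) (m + j).+1%:R `^ (- alpha) <= m%:R `^ (1 - alpha) / (alpha - 1).
Proof.
move=> m_gt0; have b_gt0 : 0 < alpha - 1 by rewrite subr_gt0.
suff : \sum_(j < M) (m + j).+1%:R `^ (- alpha) <=
    (m%:R `^ (1 - alpha) - (m + M)%:R `^ (1 - alpha)) / (alpha - 1).
  by move/le_trans; apply; rewrite ler_pM2r ?invr_gt0 // gerBl powR_ge0.
elim: M => [|M IH]; first by rewrite big_ord0 addn0 subrr mul0r.
rewrite big_ord_recr /= (le_trans (lerD IH (lexx _))) //.
have := @powR_telescope (m + M)%:R; rewrite ltr0n addn_gt0 m_gt0 => /(_ isT).
rewrite addnS -natr1 => /(lerD (lexx _)) /le_trans; apply.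
by rewrite -mulrDl addrA subrK.
Qed.

Lemma prod_powR (I : Type) (s : seq I) (x : I -> R) (a : R) :
  (forall i, 0 <= x i) -> \prod_(i <- s) x i `^ a = (\prod_(i <- s) x i) `^ a.
Proof.
move=> x_ge0; elim: s => [|i s IH]; first by rewrite !big_nil powR1.
by rewrite !big_cons IH powRM // prodr_ge0.
Qed.

Lemma prod_ratio_le (m : nat) :
  \prod_(j < m) (m%:R / j.+1%:R) <= expR m%:R :> R.
Proof.
have prodE (x : R) k : \prod_(j < k) (x / j.+1%:R) = x ^+ k / k`!%:R.
  elim: k => [|k IH]; first by rewrite big_ord0 expr0 fact0 divr1.
  rewrite big_ord_recr /= IH factS natrM exprS; field.
  by rewrite nat1r !pnatr_eq0 -lt0n fact_gt0.
rewrite prodE; case: m => [|m]; first by rewrite fact0 divr1 expr0 expR0.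
by apply: le_trans (@expR_ge1Dxn R m.+1%:R m _); rewrite ?lerDr.
Qed.

(** The first [m] factors contribute through [m ^+ m / m`! <= expR m], the
    others through [1 + y <= expR y] and the tail estimate. *)
Lemma prod_power_le (m M : nat) : (0 < m)%N ->
  \prod_(j < M) (1 + expR 1 * (m%:R / j.+1%:R) `^ alpha) <=
    expR ((ln (1 + expR 1) + alpha + expR 1 / (alpha - 1)) * m%:R).
Proof.
move=> m_gt0; have m_gt0R : 0 < m%:R :> R by rewrite ltr0n.
have alpha_gt0 : 0 < alpha by rewrite (lt_trans ltr01).
pose F (j : nat) : R := 1 + expR 1 * (m%:R / j.+1%:R) `^ alpha.
have F_ge1 j : 1 <= F j.
  by rewrite lerDl mulr_ge0 ?expR_ge0 ?powR_ge0.
have F_ge0 j : 0 <= F j by apply: le_trans (F_ge1 j).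
rewrite -[leLHS]/(\prod_(j < M) F j).
apply: le_trans (_ : \prod_(j < m + M) F j <= _).
  rewrite addnC big_split_ord /= ler_peMr ?prodr_ge0 //.
  by elim/big_ind: _ => // x y; exact: mulr_ege1.
rewrite big_split_ord /= mulrDl expRD ler_pM ?prodr_ge0 //.
  apply: le_trans (_ : \prod_(j < m) ((1 + expR 1) * (m%:R / j.+1%:R) `^ alpha) <= _).
    apply: ler_prod => j _; rewrite F_ge0 /= mulrDl lerD2r mul1r.
    rewrite [leLHS](_ : _ = 1 `^ alpha); last by rewrite powR1.
    rewrite ge0_ler_powR ?nnegrE ?divr_ge0 ?(ltW alpha_gt0) //.
    by rewrite ler_pdivlMr // mul1r ler_nat.
  rewrite big_split /= prodr_const card_ord prod_powR; last first.
    by move=> j; rewrite divr_ge0.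
  rewrite mulrDl expRD mulrC expRM_natr lnK ?posrE ?addr_gt0 ?expR_gt0 //.
  rewrite mulrC ler_pM2l ?exprn_gt0 ?addr_gt0 ?expR_gt0 //.
  have -> : expR (alpha * m%:R) = expR m%:R `^ alpha by rewrite mulrC expRM.
  apply: ge0_ler_powR; rewrite ?nnegrE ?expR_ge0 ?(ltW alpha_gt0) //.
    by apply: prodr_ge0 => j _; rewrite divr_ge0.
  exact: prod_ratio_le.
apply: le_trans (_ : \prod_(j < M) expR (expR 1 * (m%:R / (m + j).+1%:R) `^ alpha) <= _).
  by apply: ler_prod => j _; rewrite F_ge0 /= expR_ge1Dx.
rewrite -expR_sum ler_expR -mulr_sumr -[leRHS]mulrA ler_pM2l ?expR_gt0 //.
under eq_bigr => j _ do
  rewrite powRM ?invr_ge0 // -powR_inv1 // -powRrM mulN1r.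
rewrite -mulr_sumr.
apply: le_trans (ler_wpM2l (powR_ge0 _ _) (sum_powR_tail_le m M m_gt0)) _.
rewrite mulrA -powRD ?pnatr_eq0 -?lt0n ?m_gt0 ?implybT //.
by rewrite addrC subrK powRr1 // mulrC.
Qed.
End PowerSums.

Section PowerRegret.
Context {R : realType}.
Variables alpha C : R.
Hypotheses (alpha_gt1 : 1 < alpha) (C_gt1 : 1 < C).

Let alpha_gt0 : 0 < alpha. Proof. exact: lt_trans ltr01 _. Qed.
Let C_gt0 : 0 < C. Proof. exact: lt_trans ltr01 _. Qed.

Lemma power_envelope_gt0 (a : Npos) : 0 < power_envelope alpha C a.
Proof.
rewrite /power_envelope lt_min ltr01 divr_gt0 // powR_gt0 // ltr0n.
by case: a.
Qed.

(** The regret is even [O(n `^ alpha^-1)]: at the threshold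
    [m ~ (C * n) `^ alpha^-1] the letters beyond [m] are expected to occur less
    than once each, and each letter [j <= m] costs about
    [ln ((m / j) `^ alpha)], whose average over [j] is bounded. *)
Lemma power_regret_le : exists D : R, 0 < D /\ forall n : nat, (0 < n)%N ->
  (minimax_regret (laws (envelope_class (power_envelope alpha C)) n)
    <= (D * n%:R `^ alpha^-1)%:E)%E.
Proof.
pose K := ln (1 + expR 1) + alpha + expR 1 / (alpha - 1).
have K_ge0 : 0 <= K.
  rewrite !addr_ge0 ?ln_ge0 ?lerDl ?expR_ge0 ?(ltW alpha_gt0) //.
  by rewrite divr_ge0 ?expR_ge0 // subr_ge0 ltW.
have ln2_gt0 : 0 < ln (2 : R) by rewrite ln_gt0 // ltr1n.
exists ((1 + alpha + K * (C `^ alpha^-1 + 1)) / ln 2); split.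
  rewrite divr_gt0 // ltr_wpDr ?addr_gt0 // mulr_ge0 // addr_ge0 ?powR_ge0 //.
move=> n n_gt0; have nR_gt0 : 0 < n%:R :> R by rewrite ltr0n.
set y := n%:R `^ alpha^-1.
have y_ge1 : 1 <= y.
  rewrite /y [leLHS](_ : _ = 1 `^ alpha^-1); last by rewrite powR1.
  by rewrite ge0_ler_powR ?nnegrE ?invr_ge0 ?(ltW alpha_gt0) // ler1n.
pose z := C `^ alpha^-1 * y.
have z_gt0 : 0 < z by rewrite mulr_gt0 ?powR_gt0.
pose m := (Num.truncn z).+1.
have z_lt_m : z < m%:R by exact: truncnS_gt.
have m_le : m%:R <= z + 1 by rewrite -natr1 lerD2r truncn_le // ltW.
have z_alpha : z `^ alpha = C * n%:R.
  rewrite /z /y -powRM ?ltW // -powRrM mulVf ?gt_eqF // powRr1 //.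
  by rewrite mulr_ge0 // ltW.
have prod_le M : \prod_(j < M) (1 + expR 1 *
    (n%:R * power_envelope alpha C (letter j))) <= expR (K * m%:R).
  apply: le_trans (@prod_power_le R alpha alpha_gt1 m M isT).
  apply: ler_prod => j _.
  have env_gt0 := power_envelope_gt0 (letter j).
  rewrite addr_ge0 ?mulr_ge0 ?expR_ge0 ?(ltW env_gt0) //=.
  rewrite lerD2l ler_pM2l ?expR_gt0 //.
  apply: le_trans (_ : n%:R * (C / j.+1%:R `^ alpha) <= _).
    by rewrite ler_pM2l // /power_envelope ge_min lexx orbT.
  rewrite mulrA (mulrC n%:R) -z_alpha.
  rewrite powR_div // ler_pM2r ?invr_gt0 ?powR_gt0 //.
  by rewrite ge0_ler_powR ?nnegrE ?(ltW alpha_gt0) ?(ltW z_gt0) // ltW.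
apply: le_trans (envelope_regret_le _ _ power_envelope_gt0 n_gt0 _ prod_le) _.
rewrite lee_fin /log2 [leRHS]mulrAC ler_pM2r ?invr_gt0 //.
rewrite -mulrA lnM ?posrE ?mulr_gt0 ?expR_gt0 //.
rewrite lnM ?posrE ?expR_gt0 // !expRK.
have ln_n : ln n%:R <= alpha * y.
  have -> : ln n%:R = alpha * ln y.
    by rewrite /y ln_powR mulrA divff ?mul1r // gt_eqF.
  rewrite ler_pM2l //; apply: le_trans (ltW (ln_sublinear _)) _ => //.
  by apply: lt_le_trans y_ge1.
have K_le : K * m%:R <= K * (C `^ alpha^-1 + 1) * y.
  rewrite -mulrA ler_wpM2l // (le_trans m_le) // mulrDl lerD2l mul1r //.
rewrite [leRHS]mulrDl [X in _ <= X + _]mulrDl mul1r -addrA.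
by rewrite lerD // lerD.
Qed.

Lemma power_regret_near : \forall n \near \oo,
  (minimax_regret (laws (envelope_class (power_envelope alpha C)) n)
    <= ((2 * C * n%:R / (alpha - 1)) `^ alpha^-1
          * (log2 n%:R) `^ (1 - alpha^-1))%:E)%E.
Proof.
have [D [D_gt0 D_le]] := power_regret_le.
have ln2_gt0 : 0 < ln (2 : R) by rewrite ln_gt0 // ltr1n.
have b_gt0 : 0 < alpha - 1 by rewrite subr_gt0.
pose c := (2 * C / (alpha - 1)) `^ alpha^-1.
have c_gt0 : 0 < c by rewrite powR_gt0 // divr_gt0 // mulr_gt0.
have g_gt0 : 0 < 1 - alpha^-1 by rewrite subr_gt0 invf_lt1.
set g := 1 - alpha^-1 in g_gt0 *.
pose t := (D / c) `^ g^-1.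
near=> n.
have n_gt0 : (0 < n)%N by near: n; exact: nbhs_infty_gt.
have nR_gt0 : 0 < n%:R :> R by rewrite ltr0n.
have n_ge : expR (t * ln 2) <= n%:R by near: n; exact: nbhs_infty_ger.
apply: le_trans (D_le n n_gt0) _; rewrite lee_fin.
have -> : 2 * C * n%:R / (alpha - 1) = 2 * C / (alpha - 1) * n%:R by ring.
rewrite powRM // -/c; last by rewrite divr_ge0 ?mulr_ge0 // ltW.
rewrite (mulrAC c) ler_pM2r ?powR_gt0 //.
rewrite -ler_pdivrMl // [leLHS]mulrC.
have -> : D / c = t `^ g by rewrite -powRrM mulVf ?gt_eqF // powRr1 // divr_ge0 // ltW.
rewrite ge0_ler_powR ?(ltW g_gt0) // ?nnegrE ?powR_ge0 //.
  by rewrite divr_ge0 ?ln_ge0 ?ler1n ?ltW.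
by rewrite /log2 ler_pdivlMr // -ler_expR lnK.
Unshelve. all: by end_near. Qed.

End PowerRegret.

(** * Memoryless sources by arithmetic coding *)

Section ArithmeticCoding.
Context {R : realType}.
Variable p : nat -> R.
Hypothesis p_gt0 : forall k, 0 < p k.
Hypothesis p_sum1 : series p @ \oo --> (1 : R).

Let F k : R := \sum_(j < k) p j.

Let FS k : F k.+1 = F k + p k. Proof. by rewrite /F big_ord_recr. Qed.

Let F_le j k : (j <= k)%N -> F j <= F k.
Proof.
move=> /subnK <-; elim: (k - j)%N => [//|i IH].
by rewrite addSn FS (le_trans IH) // lerDl ltW.
Qed.

Let F_seriesE k : series p k = F k. Proof. by rewrite /series /= big_mkord. Qed.

Let F_le1 k : F k <= 1.
Proof.
have nd : nondecreasing_seq (series p).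
  by move=> i j ij; rewrite !F_seriesE F_le.
have := nondecreasing_cvgn_le nd; rewrite -F_seriesE (cvg_lim _ p_sum1) //.
by apply.
Qed.

Let F_gt u : u < 1 -> exists k, u < F k.
Proof.
move=> u_lt1.
have /cvgrPdist_lt/(_ (1 - u)) := p_sum1; rewrite subr_gt0 => /(_ u_lt1).
move=> [k _ /(_ k (leqnn k))]; rewrite F_seriesE => /ltr_distlBl k_dist.
by exists k; move: k_dist; lra.
Qed.

(** One step of the decoder: the unit interval is cut into consecutive intervals
    of lengths [p 0], [p 1], ...; the interval that contains [u] gives the
    letter, and [rescale] stretches it back to the unit interval. *)
Definition first_letter (u : R) : nat :=
  xget 0%N [set k | \sum_(j < k) p j <= u < \sum_(j < k.+1) p j].

Definition rescale (u : R) : R :=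
  (u - \sum_(j < first_letter u) p j) / p (first_letter u).

Lemma first_letterP u k : 0 <= u < 1 ->
  (first_letter u == k) = (\sum_(j < k) p j <= u < \sum_(j < k.+1) p j).
Proof.
move=> /andP[u_ge0 u_lt1].
have [k0 k0P] : exists k, F k <= u < F k.+1.
  have ex := F_gt u u_lt1; case: (ex_minnP ex) => -[|k0].
    by rewrite /F big_ord0 ltNge u_ge0.
  move=> u_lt min_k0; exists k0; rewrite u_lt andbT leNgt; apply/negP => /min_k0.
  by rewrite ltnn.
have uniq_k i j : F i <= u < F i.+1 -> F j <= u < F j.+1 -> (i <= j)%N.
  move=> /andP[Fi _] /andP[_ Fj]; rewrite leqNgt; apply/negP => /F_le Fji.
  by have := lt_le_trans Fj (le_trans Fji Fi); rewrite ltxx.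
have fP : F (first_letter u) <= u < F (first_letter u).+1.
  exact: (@xgetPex _ 0%N [set k | F k <= u < F k.+1] (ex_intro _ k0 k0P)).
apply/idP/idP => [/eqP <- //|kP].
by rewrite eqn_leq !uniq_k.
Qed.

Lemma rescale_itv u : 0 <= u < 1 -> 0 <= rescale u < 1.
Proof.
move=> u01; have := first_letterP u (first_letter u) u01.
rewrite eqxx => /esym/andP[F_le_u]; rewrite -/(F _) FS => u_lt.
rewrite /rescale divr_ge0 ?subr_ge0 ?(ltW (p_gt0 _)) //=.
by rewrite ltr_pdivrMr // mul1r ltrBlDl.
Qed.

(** The numbers whose decoded word starts with [b] form an interval, by
    [prefixP]; this is its left end. *)
Fixpoint prefix_start (b : seq nat) : R :=
  if b is k :: b' then \sum_(j < k) p j + p k * prefix_start b' else 0.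

Definition prefix_length (b : seq nat) : R := \prod_(k <- b) p k.

Let prefix_length_gt0 b : 0 < prefix_length b.
Proof. by apply/prodr_gt0 => k _. Qed.

Lemma prefix_bounds b :
  0 <= prefix_start b /\ prefix_start b + prefix_length b <= 1.
Proof.
elim: b => [|k b [start_ge0 end_le1]] /=.
  by rewrite /prefix_length big_nil add0r.
rewrite addr_ge0 ?mulr_ge0 ?sumr_ge0 ?(ltW (p_gt0 _)) //; last first.
  by move=> j _; exact: ltW.
split=> //; rewrite /prefix_length big_cons -addrA -mulrDr.
by apply: le_trans (F_le1 k.+1); rewrite FS lerD2l ler_piMr // ltW.
Qed.

Fixpoint prefix (n : nat) (u : R) : seq nat :=
  if n is n'.+1 then first_letter u :: prefix n' (rescale u) else [::].

Lemma prefixP b u : 0 <= u < 1 ->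
  (prefix (size b) u == b) =
  (prefix_start b <= u < prefix_start b + prefix_length b).
Proof.
elim: b u => [|k b IH] u u01 /=.
  by rewrite eqxx /prefix_length big_nil add0r u01.
rewrite eqseq_cons IH ?rescale_itv //.
have [start_ge0 end_le1] := prefix_bounds b.
rewrite /prefix_length big_cons -/(prefix_length b) -addrA -mulrDr.
have [<-|k_neq] /= := eqVneq (first_letter u) k.
  set i := first_letter u; rewrite /rescale -/i.
  rewrite ler_pdivlMr // ltr_pdivrMr // lerBrDl ltrBlDl.
  by rewrite ![_ * p i]mulrC.
apply/esym/negP => /andP[ge_u lt_u]; case/negP: k_neq.
rewrite first_letterP // -!/(F _) FS; apply/andP; split.
  by apply: le_trans ge_u; rewrite lerDl mulr_ge0 // ltW.
by apply: lt_le_trans lt_u _; rewrite lerD2l ler_piMr // ltW.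
Qed.

Lemma nth_prefix n t u : (t < n)%N ->
  nth 0%N (prefix n u) t = first_letter (iter t rescale u).
Proof.
by elim: n t u => // n IH [|t] u //= t_lt; rewrite IH // -iterSr.
Qed.

Lemma size_prefix n u : size (prefix n u) = n.
Proof. by elim: n u => //= n IH u; rewrite IH. Qed.

Variable h : nat -> Npos.
Hypothesis h_inj : injective h.

(** Decoding the numbers outside [0, 1) like 0 keeps the decoder measurable on
    the whole line. *)
Definition arithmetic_decoder (u : R) : g_sigma_algebraType symbol_events :=
  fun t => h (first_letter (iter t rescale (if 0 <= u < 1 then u else 0))).

(** On [0, 1) the event that symbol [i] is [a] is a countable union of
    the intervals of the prefixes of length [i.+1] that end in [a]. *)
Lemma measurable_arithmetic_decoder :
  measurable_fun [set: measurableTypeR R] arithmetic_decoder.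
Proof.
apply: (@measurability _ _ (measurableTypeR R) (g_sigma_algebraType symbol_events)
  setT arithmetic_decoder symbol_events erefl).
move=> _ [_ [i [a ->]] <-]; rewrite setTI.
pose J (b : i.+1.-tuple nat) : set (measurableTypeR R) :=
  if h (nth 0%N b i) == a
  then `[prefix_start b, prefix_start b + prefix_length b[%classic else set0.
pose J0 : set (measurableTypeR R) :=
  if h (first_letter (iter i rescale 0)) == a then ~` `[0, 1[%classic else set0.
rewrite (_ : _ @^-1` _ = (`[0, 1[ `&` \bigcup_b J b) `|` J0); last first.
  apply/seteqP; split=> u.
    rewrite /preimage /= /arithmetic_decoder => ua.
    case: ifPn ua => [u01|u01] /eqP ua; last first.
      by right; rewrite /J0 ua /= in_itv /=; exact/negP.
    left; split; first by rewrite /= in_itv.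
    have sz : size (prefix i.+1 u) == i.+1 by rewrite size_prefix.
    have := ua; rewrite -(@nth_prefix i.+1) // => {}ua.
    exists (Tuple sz) => //; rewrite /J ua.
    have := prefixP (prefix i.+1 u) u u01; rewrite size_prefix eqxx => /esym.
    by rewrite /= in_itv /=.
  rewrite /preimage /= /arithmetic_decoder => -[[u01 [b _]]|].
    rewrite /J; case: ifP => // /eqP ba.
    rewrite /= in_itv /= in u01; rewrite /= in_itv /= -prefixP // size_tuple.
    by rewrite u01 -(@nth_prefix i.+1) // => /eqP ->.
  rewrite /J0; case: ifP => // /eqP ba /=.
  by rewrite in_itv /= => /negP/negPf ->.
apply: measurableU; last first.
  rewrite /J0; case: ifP => // _; apply: measurableC; exact: measurable_itv.
apply: measurableI; first exact: measurable_itv.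
apply: countable_bigcupT_measurable => // b.
by rewrite /J; case: ifP => // _; exact: measurable_itv.
Qed.

Lemma uniform_probE (S : set (measurableTypeR R)) : measurable S ->
  uniform_prob (@ltr01 R) S = lebesgue_measure (S `&` `[0, 1]).
Proof.
move=> mS; rewrite /uniform_prob integral_uniform_pdf.
rewrite (@eq_integral _ _ _ _ _ (cst 1%E)); last first.
  move=> u; rewrite inE => -[_ /=]; rewrite in_itv /= /uniform_pdf => ->.
  by rewrite subr0 invr1.
rewrite integral_cst ?mul1e //.
by apply: measurableI => //; exact: measurable_itv.
Qed.

Lemma iid_source_exists : exists P : source R,
  (forall n (b : n.-tuple nat),
     law P (map_tuple h b) = \prod_(t < n) p (tnth b t)) /\
  (forall n (x : n.-tuple Npos) (t : 'I_n),
     (forall k, tnth x t <> h k) -> law P x = 0).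
Proof.
pose X : {mfun measurableTypeR R >-> g_sigma_algebraType symbol_events} :=
  HB.pack arithmetic_decoder
    (isMeasurableFun.Build _ _ _ _ _ measurable_arithmetic_decoder).
exists (distribution (uniform_prob (@ltr01 R)) X); split=> n b; last first.
  move=> t bt; rewrite /law -[RHS]/(fine (0%:E : \bar R)); congr fine.
  rewrite -[LHS]/(uniform_prob (@ltr01 R) (arithmetic_decoder @^-1`
    [set w : nat -> Npos | forall i : 'I_n, w i = tnth b i])).
  rewrite (_ : _ @^-1` _ = set0) ?measure0 // -subset0 => u.
  by rewrite /preimage /= => /(_ t)/esym/bt.
pose cyl := [set w : nat -> Npos | forall i : 'I_n, w i = tnth (map_tuple h b) i].
pose S := X @^-1` cyl.
have mS : measurable S.
  rewrite -[S]setTI; apply: measurable_arithmetic_decoder => //.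
  exact: measurable_cylinder.
have S01 u : 0 <= u < 1 -> S u <->
    prefix_start b <= u < prefix_start b + prefix_length b.
  move=> u01; rewrite -prefixP // size_tuple /S /cyl /preimage /=.
  rewrite /arithmetic_decoder u01; split=> [ub|/eqP ub i].
    apply/eqP; apply: (@eq_from_nth _ 0%N); first by rewrite size_prefix size_tuple.
    move=> t; rewrite size_prefix => t_lt; rewrite nth_prefix //.
    have /h_inj := etrans (ub (Ordinal t_lt)) (tnth_map _ _ _).
    by rewrite (tnth_nth 0%N).
  by rewrite tnth_map (tnth_nth 0%N) -ub nth_prefix.
have -> : \prod_(t < n) p (tnth b t) = prefix_length b.
  by rewrite /prefix_length big_tuple.
have [start_ge0 end_le1] := prefix_bounds b.
have len_gt0 := prefix_length_gt0 b.
pose I := `[prefix_start b, prefix_start b + prefix_length b[%classic.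
have mI : measurable (I : set (measurableTypeR R)) by exact: measurable_itv.
have lebI : lebesgue_measure I = (prefix_length b)%:E.
  rewrite lebesgue_measure_itv /= lte_fin ltrDl len_gt0 -EFinB.
  by rewrite addrAC subrr add0r.
have I_sub u : I u -> 0 <= u < 1.
  rewrite /I /= in_itv /= => /andP[ge_u lt_u].
  by rewrite (le_trans start_ge0 ge_u) (lt_le_trans lt_u end_le1).
rewrite /law -[RHS]/(fine (prefix_length b)%:E); congr fine.
rewrite -[LHS]/(uniform_prob (@ltr01 R) S) uniform_probE //.
have mS01 : measurable (S `&` `[0, 1] : set (measurableTypeR R)).
  by apply: measurableI => //; exact: measurable_itv.
(* [uniform_prob] lives on the closed interval; the point 1, which the decoder
   does not treat like its left neighbours, is negligible. *)
apply/eqP; rewrite -lebI eq_le; apply/andP; split.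
  apply: le_trans (_ : lebesgue_measure (I `|` [set 1%R]) <= _)%E.
    apply: le_measure; rewrite ?inE //.
      by apply: measurableU => //; exact: measurable_set1.
    move=> u [Su /=]; rewrite in_itv /= => /andP[u_ge0 u_le1].
    have [->|u_neq1] := eqVneq u 1; [by right|left].
    have u01 : 0 <= u < 1 by rewrite u_ge0 lt_neqAle u_neq1.
    by rewrite /I /= in_itv /=; apply/S01.
  have m1 : measurable ([set 1] : set (measurableTypeR R)).
    exact: measurable_set1.
  have := @measureU2 _ _ _ (@lebesgue_measure R) _ _ mI m1.
  by rewrite [X in (_ <= _ + X)%E]lebesgue_measure_set1 adde0.
apply: le_measure; rewrite ?inE // => u Iu.
have u01 := I_sub u Iu; split.
  by apply/S01 => //; move: Iu; rewrite /I /= in_itv.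
by rewrite /= in_itv /=; case/andP: u01 => -> /ltW ->.
Qed.

End ArithmeticCoding.

(** * Redundancy and mutual information *)

Section RedundancyCapacity.
Context {R : realType} {T : choiceType}.
Implicit Types p q r : T -> R.

Let ln2_gt0 : 0 < ln (2 : R). Proof. by rewrite ln_gt0 // ltr1n. Qed.

(** Any reference value [u] may replace [b] in [ln (a / b)] at the price of the
    linear correction [b / u - 1], since [ln y <= y - 1]. *)
Lemma log2_ratio_ge (a b u : R) : 0 <= a -> 0 <= b -> (0 < a -> 0 < u) ->
  ((a * (ln (a / u) + 1 - b / u) / ln 2)%:E <= a%:E * log2_ratio a b)%E.
Proof.
move=> a_ge0 b_ge0 u_gt0.
have [->|a_neq0] := eqVneq a 0; first by rewrite !mul0r mul0e.
have a_gt0 : 0 < a by rewrite lt_neqAle eq_sym a_neq0.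
have {}u_gt0 := u_gt0 a_gt0.
rewrite /log2_ratio inver; have [b0|b_neq0] := eqVneq b 0.
  rewrite gt0_muley ?lte_fin // gt0_mulye ?lte_fin ?invr_gt0 //.
  by rewrite gt0_muley ?lte_fin // leey.
have b_gt0 : 0 < b by rewrite lt_neqAle eq_sym b_neq0.
rewrite -EFinM lne_EFin ?divr_gt0 // -!EFinM lee_fin mulrA.
rewrite ler_pM2r ?invr_gt0 // ler_pM2l //.
have -> : a / b = (a / u) / (b / u).
  by field; rewrite !gt_eqF.
rewrite [leRHS]ln_div ?posrE ?divr_gt0 //.
have bu_gt0 : 0 < b / u by rewrite divr_gt0.
have := @le_ln1Dx R (b / u - 1); rewrite addrCA subrr addr0.
by have -> : -1 < b / u - 1 by [lra]; move=> /(_ isT); lra.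
Qed.

Lemma esum_mem (s : seq T) (a : T -> R) : uniq s -> (forall x, 0 <= a x) ->
  (\esum_(x in [set: T]) (if x \in s then a x else 0)%:E =
   (\sum_(x <- s) a x)%:E)%E.
Proof.
move=> uniq_s a_ge0.
transitivity (\esum_(x in [set` s]) (a x)%:E)%E.
  rewrite [RHS]esum_mkcond; apply: eq_esum => x _.
  by rewrite mem_setE; case: ifP.
by rewrite esum_fset -?fsbig_seq ?sumEFin // => x _; rewrite lee_fin.
Qed.

(** As [q] has total mass 1 and [p] at least 1, the divergence is at least the sum
    of the nonnegative terms [(p ln (p / q) - p + q) / ln 2], hence at least any
    finite partial sum, whose terms are bounded below with the reference [r]. *)
Lemma kl_div_ge p q r (s : seq T) : (forall x, 0 <= p x) -> Defs.pmf q ->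
  (1 <= \esum_(x in [set: T]) (p x)%:E)%E ->
  (forall x, 0 < p x -> 0 < r x) -> uniq s ->
  (((\sum_(x <- s) (p x * (ln (p x / r x) - q x / r x) + q x)) / ln 2)%:E
     <= kl_div p q)%E.
Proof.
move=> p_ge0 [q_ge0 q_sum] p_sum r_gt0 uniq_s.
pose c : R := (ln 2)^-1; have c_gt0 : 0 < c by rewrite invr_gt0.
pose e x := p x * (ln (p x / r x) - q x / r x) + q x.
pose t x := ((p x)%:E * log2_ratio (p x) (q x))%E.
pose e' x := if x \in s then e x else 0.
have t_ge x : ((c * (e' x + p x - q x))%:E <= t x)%E.
  rewrite /e'; case: ifP => _.
    apply: le_trans (@log2_ratio_ge (p x) (q x) (r x) _ _ _) => //; last exact: r_gt0.
    by rewrite lee_fin mulrC ler_pM2r // /e; lra.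
  apply: le_trans (@log2_ratio_ge (p x) (q x) (p x) _ _ _) => //.
  rewrite lee_fin mulrC ler_pM2r //.
  have [->|p_neq0] := eqVneq (p x) 0.
    by rewrite mul0r; have := q_ge0 x; lra.
  by rewrite divff // ln1 !mulrDr mulrN mulrCA divff //; lra.
pose A := (\esum_(x in [set: T]) t^\+ x)%E.
pose B := (\esum_(x in [set: T]) t^\- x)%E.
(* No difference of infinite sums may be formed before the negative parts are
   known to be summable, so all terms are moved to the side where they are
   nonnegative. *)
pose ep x := if x \in s then Num.max (e x) 0 else 0.
pose en x := if x \in s then Num.max (- e x) 0 else 0.
have ep_ge0 x : 0 <= ep x by rewrite /ep; case: ifP => // _; rewrite le_max lexx orbT.
have en_ge0 x : 0 <= en x by rewrite /en; case: ifP => // _; rewrite le_max lexx orbT.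
have epn x : ep x - en x = e' x.
  rewrite /ep /en /e'; case: ifP => _; last by rewrite subr0.
  by case: (leP (e x) 0) => e0; case: (leP (- e x) 0) => ne0; lra.
have t_split x : ((c * (ep x + p x))%:E + t^\- x <= t^\+ x + (c * (q x + en x))%:E)%E.
  have := t_ge x; rewrite funeposE funenegE.
  case: (t x) => [v| |] //=.
    rewrite -!EFin_max -!EFinD !lee_fin -epn => le_v.
    have -> : Num.max v 0 = v + Num.max (- v) 0.
      by case: (leP v 0) => v0; case: (leP (- v) 0) => nv0; lra.
    by rewrite !mulrDr in le_v *; rewrite mulrN in le_v; lra.
  by rewrite /= maxye ?leey // => _; rewrite addye ?leey.
have sum_split : ((c * (\sum_(x <- s) Num.max (e x) 0 + 1))%:E + B <=
    A + (c * (1 + \sum_(x <- s) Num.max (- e x) 0))%:E)%E.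
  have ts_ge0 (f : T -> \bar R) : forall x, [set: T] x -> (0 <= f^\+ x)%E.
    by move=> x _; exact: funepos_ge0.
  have tn_ge0 (f : T -> \bar R) : forall x, [set: T] x -> (0 <= f^\- x)%E.
    by move=> x _; exact: funeneg_ge0.
  apply: le_trans (_ : \esum_(x in [set: T]) ((c * (ep x + p x))%:E + t^\- x) <= _)%E.
    rewrite esumD //; last by move=> x _; rewrite lee_fin mulr_ge0 ?addr_ge0 ?(ltW c_gt0).
    rewrite leeD2r // esumZl // EFinM lee_pmul2l ?lte_fin //.
    under eq_esum do rewrite EFinD.
    rewrite esumD ?EFinD; [|by move=> x _; rewrite lee_fin..].
    by rewrite esum_mem ?leeD2l // => x; rewrite le_max lexx orbT.
  apply: le_trans (le_esum (fun x _ => t_split x)) _.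
  rewrite esumD //; last by move=> x _; rewrite lee_fin mulr_ge0 ?addr_ge0 ?(ltW c_gt0).
  rewrite leeD2l // esumZl // EFinM lee_pmul2l ?lte_fin //.
  under eq_esum do rewrite EFinD.
  rewrite esumD ?EFinD; [|by move=> x _; rewrite lee_fin..].
  by rewrite esum_mem ?q_sum // => x; rewrite le_max lexx orbT.
have B_le : (B <= c%:E)%E.
  rewrite -[leRHS]mule1 -q_sum -esumZl //; apply: le_esum => x _.
  rewrite funenegE ge_max; apply/andP; split; last by rewrite lee_fin mulr_ge0 // ltW.
  have := @log2_ratio_ge (p x) (q x) (p x) (p_ge0 x) (q_ge0 x) id.
  rewrite -/(t x) leeNl -EFinN; apply: le_trans; rewrite lee_fin [leRHS]mulrC -mulrN.
  rewrite ler_pM2l //; have [->|p_neq0] := eqVneq (p x) 0.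
    by rewrite mul0r; have := q_ge0 x; lra.
  by rewrite divff // ln1 !mulrDr mulrN mulrCA divff //; have := p_ge0 x; lra.
have B_ge0 : (0 <= B)%E by apply: esum_ge0 => x _; exact: funeneg_ge0.
rewrite /kl_div -/t -/A -/B.
have E_split : \sum_(x <- s) e x =
    \sum_(x <- s) Num.max (e x) 0 - \sum_(x <- s) Num.max (- e x) 0.
  rewrite -sumrB; apply: eq_bigr => x _.
  by case: (leP (e x) 0) => e0; case: (leP (- e x) 0) => ne0; lra.
rewrite E_split mulrC -/c; move: B_ge0 B_le sum_split.
case: B => [b| |] //= _ _; case: A => [a| |] //=; last by move=> _; rewrite addye // leey.
by rewrite -!EFinD !lee_fin !mulrDr mulrN; lra.
Qed.

End RedundancyCapacity.

(** The redundancy is at least the mutual information between a uniformly drawn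
    source and its output, here restricted to the outputs in [s]: averaging
    [kl_div_ge] over the sources with their mixture as the reference cancels the
    terms in [q]. *)
Lemma minimax_redundancy_ge_information (R : realType) (T : choiceType)
    (Theta : finType) (P : Theta -> T -> R) (G : set (T -> R)) (s : seq T)
    (r : T -> R := fun x => (\sum_i P i x) / #|Theta|%:R) :
  (0 < #|Theta|)%N -> (forall i, G (P i)) -> (forall i x, 0 <= P i x) ->
  (forall i, (1 <= \esum_(x in [set: T]) (P i x)%:E)%E) -> uniq s ->
  (((\sum_i \sum_(x <- s) P i x * ln (P i x / r x)) / (#|Theta|%:R * ln 2))%:E
     <= minimax_redundancy G)%E.
Proof.
move=> Theta_gt0 GP P_ge0 P_sum uniq_s.
have ln2_gt0 : 0 < ln (2 : R) by rewrite ln_gt0 // ltr1n.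
have N_gt0 : 0 < #|Theta|%:R :> R by rewrite ltr0n.
have r_ge i x : P i x <= #|Theta|%:R * r x.
  rewrite mulrC divfK ?gt_eqF // (bigD1 i) //= lerDl sumr_ge0 //.
have r_gt0 i x : 0 < P i x -> 0 < r x.
  by move=> /lt_le_trans/(_ (r_ge i x)); rewrite pmulr_rgt0.
apply: le_ereal_inf_tmp => _ [q q_pmf <-].
set S := ereal_sup _.
have P_le i : (((\sum_(x <- s) (P i x * (ln (P i x / r x) - q x / r x) + q x)) /
    ln 2)%:E <= S)%E.
  apply: le_trans (kl_div_ge _ _ r s (P_ge0 i) q_pmf (P_sum i) (r_gt0 i) uniq_s) _.
  by apply: ereal_sup_ubound; exists (P i).
case: S P_le => [v| |] P_le; [|by rewrite leey|]; last first.
  by case/card_gt0P: Theta_gt0 => i _; have := P_le i.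
rewrite lee_fin invfM mulrCA ler_pdivrMl //.
have [q_ge0 _] := q_pmf.
apply: le_trans (_ : (\sum_i \sum_(x <- s)
    (P i x * (ln (P i x / r x) - q x / r x) + q x)) / ln 2 <= _).
  rewrite ler_pM2r ?invr_gt0 // -subr_ge0 -sumrB.
  under eq_bigr do rewrite -sumrB.
  rewrite exchange_big /= sumr_ge0 // => x _.
  have -> : \sum_i (P i x * (ln (P i x / r x) - q x / r x) + q x -
      P i x * ln (P i x / r x)) = #|Theta|%:R * (q x - r x * (q x / r x)).
    have rE : #|Theta|%:R * r x = \sum_i P i x by rewrite mulrC divfK ?gt_eqF.
    rewrite mulrBr (mulrA _ (r x)) rE mulr_suml.
    rewrite [in RHS]mulr_natl -sumr_const -sumrB.
    by apply: eq_bigr => i _; ring.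
  rewrite mulr_ge0 // subr_ge0.
  have [->|r_neq0] := eqVneq (r x) 0; first by rewrite mul0r.
  by rewrite mulrCA divff // mulr1.
rewrite mulr_suml mulr_natl -sumr_const; apply: ler_sum => i _.
by have := P_le i; rewrite lee_fin.
Qed.

(** A function with prescribed values at the letters of [b] is free elsewhere. *)
Lemma card_ffun_through (I J : finType) (n : nat) (b : n.-tuple I)
    (c : n.-tuple J) :
  (#|[pred th : {ffun I -> J} | [forall t, th (tnth b t) == tnth c t]]| *
     #|J| ^ #|[pred k | k \in b]| <= #|J| ^ #|I|)%N.
Proof.
pose Q (k : I) : pred J :=
  fun j => [forall t, (tnth b t == k) ==> (j == tnth c t)].
apply: (@leq_trans (#|family Q| * #|J| ^ #|[pred k | k \in b]|)).
  rewrite leq_mul2r; apply/orP; right; apply/subset_leq_card/fintype.subsetP => th.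
  rewrite inE => /forallP th_c; apply/familyP => k; rewrite unfold_in.
  by apply/forallP => t; apply/implyP => /eqP <-; exact: th_c.
rewrite card_family foldrE big_image /=.
rewrite -[X in (_ * X)%N]prod_nat_const [X in (_ * X)%N]big_mkcond -big_split /=.
rewrite -[leqRHS]prod_nat_const; apply: leq_prod => k _; case: ifP => kb.
  rewrite -[leqRHS]mul1n leq_mul2r; apply/orP; right.
  have /tnthP[t kt] := kb.
  rewrite -(card1 (tnth c t)); apply/subset_leq_card/fintype.subsetP => j.
  by rewrite unfold_in => /forallP/(_ t); rewrite -kt eqxx.
by rewrite muln1 max_card.
Qed.

(** The expected number of distinct letters of an i.i.d. word: the letter [k]
    is avoided with probability [(\sum_j p j - p k) ^+ n]. *)
Lemma sum_occurring_letters (R : comNzRingType) (M n : nat) (p : 'I_M -> R) :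
  \sum_(b : n.-tuple 'I_M)
     (\prod_(t < n) p (tnth b t)) * #|[pred k | k \in b]|%:R =
  \sum_(k < M) ((\sum_j p j) ^+ n - (\sum_j p j - p k) ^+ n).
Proof.
pose avoid (k j : 'I_M) := if j == k then 0 else p j.
have avoid_sum k : \sum_j avoid k j = \sum_j p j - p k.
  rewrite [in RHS](bigD1 k) //= [in LHS](bigD1 k) //= /avoid eqxx add0r.
  rewrite addrAC subrr add0r; apply: eq_bigr => j /negPf.
  by rewrite /avoid => ->.
under [RHS]eq_bigr do rewrite -avoid_sum -!sum_tuple_prod -sumrB.
rewrite exchange_big; apply: eq_bigr => b _ /=.
rewrite -sum1_card natr_sum mulr_sumr big_mkcond /=; apply: eq_bigr => k _.
rewrite inE; case: ifP => [/tnthP[t kt]|kb].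
  by rewrite mulr1 [X in _ - X](bigD1 t) //= /avoid -kt eqxx mul0r subr0.
rewrite [X in _ - X](eq_bigr (fun t => p (tnth b t))) ?subrr // => t _.
rewrite /avoid ifN //; apply/eqP => bk.
by rewrite -bk mem_tnth in kb.
Qed.

(** * Sources that select one letter per block *)

Lemma cvg_expn (R : realType) (u : nat -> R) (l : R) (n : nat) :
  u @ \oo --> l -> (u k ^+ n) @[k --> \oo] --> (l ^+ n : R).
Proof.
move=> u_cvg; elim: n => [|n IH].
  by rewrite expr0; under eq_fun do rewrite expr0; exact: cvg_cst.
by rewrite exprS; under eq_fun do rewrite exprS; exact: cvgM.
Qed.

Section BlockSources.
Context {R : realType}.
Variable p : nat -> R.
Hypothesis p_gt0 : forall k, 0 < p k.
Hypothesis p_sum1 : series p @ \oo --> (1 : R).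
Variable m : nat.
Hypothesis m_gt0 : (0 < m)%N.

(** The letters are cut into blocks of length [m], and the selector [th] picks one
    letter in each block. *)
Definition block_letter (th : nat -> nat) (k : nat) : Npos :=
  letter (k * m + th k).

Lemma block_letter_eq (th : nat -> nat) k j i : (forall k, th k < m)%N ->
  (j < m)%N -> letter (k * m + j) = block_letter th i -> k = i /\ j = th i.
Proof.
move=> th_lt j_lt /letter_inj kj.
have ki : k = i.
  have := congr1 (fun x => x %/ m)%N kj.
  by rewrite !divnMDl // !divn_small // !addn0.
by split=> //; move: kj; rewrite ki => /addnI.
Qed.

(** The source of the selector [th], described by its finite-dimensional laws:
    they are all that redundancies see. *)
Definition block_source (th : nat -> nat) (P : source R) : Prop :=
  (forall n (b : n.-tuple nat),
     law P (map_tuple (block_letter th) b) = \prod_(t < n) p (tnth b t)) /\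
  (forall n (x : n.-tuple Npos) (t : 'I_n),
     (forall k, tnth x t <> block_letter th k) -> law P x = 0).

Lemma block_source_exists (th : nat -> nat) : (forall k, th k < m)%N ->
  exists P, block_source th P.
Proof.
move=> th_lt; apply: iid_source_exists => // i j ij.
by have [] := block_letter_eq th i (th i) j th_lt (th_lt i) ij.
Qed.

(** The words over the first [M] blocks have total mass
    [(\sum_(j < M) p j) ^+ n], which tends to 1. *)
Lemma block_source_mass (th : nat -> nat) P n : (forall k, th k < m)%N ->
  block_source th P ->
  (1 <= \esum_(x in [set: n.-tuple Npos]) (law P x)%:E)%E.
Proof.
move=> th_lt [P_law _]; set S := (X in (_ <= X)%E).
have S_ge M : (((\sum_(j < M) p j) ^+ n)%:E <= S)%E.
  pose h (b : n.-tuple 'I_M) := map_tuple (block_letter th) (map_tuple val b).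
  have h_inj : injective h.
    move=> b c bc; apply: eq_from_tnth => t; apply/val_inj.
    have := congr1 (fun x => tnth x t) bc; rewrite !tnth_map => bct.
    by have [] := block_letter_eq th _ _ _ th_lt (th_lt _) bct.
  have := le_sum_esum _ h (fun x => law P x) h_inj.
  apply: le_trans; rewrite lee_fin.
  rewrite -(sum_tuple_prod _ _ n (fun j : 'I_M => p j)).
  apply: ler_sum => b _; rewrite P_law.
  by under [leRHS]eq_bigr do rewrite tnth_map.
have : S != -oo%E by rewrite gt_eqF // (lt_le_trans _ (S_ge 0%N)) // ltNyr.
case: S S_ge => [v| |] // S_ge _; last by rewrite leey.
rewrite lee_fin.
have pow_cvg : (series p k) ^+ n @[k --> \oo] --> (1 : R).
  by rewrite -[X in _ --> X](expr1n R n); exact: cvg_expn.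
rewrite -(cvg_lim _ pow_cvg) //; apply: limr_le; first exact: cvgP pow_cvg.
by near=> k; rewrite /series /= big_mkord -lee_fin.
Unshelve. all: by end_near. Qed.

Variables (G : set (source R)) (n : nat).
Hypothesis G_blocks : forall th P, (forall k, th k < m)%N ->
  block_source th P -> G P.

(** The selector [th] restricted to the first [M] blocks is drawn uniformly.
    A word reveals [th] exactly on the blocks that it visits, so its mixture
    probability is smaller than its probability by the factor [m ^ z], with [z]
    the number of visited blocks. *)
Lemma redundancy_ge_blocks (M : nat) :
  ((ln m%:R / ln 2 *
     \sum_(k < M) ((\sum_(j < M) p j) ^+ n - (\sum_(j < M) p j - p k) ^+ n))%:E
   <= minimax_redundancy (laws G n))%E.
Proof.
pose Th := {ffun 'I_M -> 'I_m}.
pose ext (th : Th) (k : nat) : nat := if insub k is Some i then th i else 0%N.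
have ext_lt th k : (ext th k < m)%N by rewrite /ext; case: insub.
have extE th (i : 'I_M) : ext th i = th i.
  by rewrite /ext insubT // => i_lt; congr (val (th _)); apply/val_inj.
have /fin_all_exists[src src_block] (th : Th) : exists P, block_source (ext th) P.
  by apply: block_source_exists => k; exact: ext_lt.
have Th_gt0 : (0 < #|Th|)%N by rewrite card_ffun !card_ord expn_gt0 m_gt0.
pose emb (y : n.-tuple ('I_M * 'I_m)) : n.-tuple Npos :=
  map_tuple (fun kj : 'I_M * 'I_m => letter (kj.1 * m + kj.2)) y.
have emb_inj : injective emb.
  move=> y y' /(congr1 (fun x => tnth x _)) yy; apply: eq_from_tnth => t.
  have := yy t; rewrite !tnth_map.
  case: (tnth y t) (tnth y' t) => [k j] [k' j'] /= kj.
  have [] := block_letter_eq (fun=> val j') k j k' (fun=> ltn_ord j') (ltn_ord j) kj.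
  by move=> /val_inj -> /val_inj ->.
pose s := map emb (index_enum _).
have uniq_s : uniq s by rewrite map_inj_uniq ?index_enum_uniq.
pose r (x : n.-tuple Npos) := (\sum_th law (src th) x) / #|Th|%:R.
pose path (th : Th) (b : n.-tuple 'I_M) : n.-tuple ('I_M * 'I_m) :=
  map_tuple (fun k => (k, th k)) b.
pose pi (b : n.-tuple 'I_M) := \prod_(t < n) p (tnth b t).
have pi_gt0 b : 0 < pi b by apply/prodr_gt0 => t _.
have law_path th b : law (src th) (emb (path th b)) = pi b.
  have [/(_ n (map_tuple val b)) P_law _] := src_block th.
  transitivity (law (src th) (map_tuple (block_letter (ext th)) (map_tuple val b))).
    congr law; apply: eq_from_tnth => t; rewrite !tnth_map /=.
    by rewrite /block_letter extE.
  by rewrite P_law; apply: eq_bigr => t _; rewrite tnth_map.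
(* An output of the source [th] is determined by its blocks. *)
have law_off th (y : n.-tuple ('I_M * 'I_m)) :
    y != path th (map_tuple fst y) -> law (src th) (emb y) = 0.
  move=> y_off; have [t yt] : exists t, (tnth y t).2 != th (tnth y t).1.
    apply/existsP; apply: contraNT y_off => /existsPn y_on.
    apply/eqP/eq_from_tnth => t; rewrite !tnth_map; have := y_on t.
    by rewrite negbK; case: (tnth y t) => k j /= /eqP ->.
  have [_ /(_ n (emb y) t)] := src_block th; apply => k.
  rewrite tnth_map => kj.
  have [ki ji] := block_letter_eq _ _ _ _ (ext_lt th) (ltn_ord _) kj.
  by case/eqP: yt; apply/val_inj; rewrite /= -extE ki.
(* Conversely, the sources that can produce [path th b] are those that agree
   with [th] on the blocks of [b]. *)
have r_le th b : r (emb (path th b)) * m%:R ^+ #|[pred k | k \in b]| <= pi b.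
  rewrite /r mulrAC ler_pdivrMr ?ltr0n //.
  pose A := [pred th' : Th | [forall t, th' (tnth b t) == tnth (map_tuple th b) t]].
  apply: le_trans (_ : pi b * #|A|%:R * m%:R ^+ #|[pred k | k \in b]| <= _).
    rewrite ler_wpM2r ?exprn_ge0 // -sum1_card natr_sum mulr_sumr.
    rewrite [leRHS]big_mkcond /=; apply: ler_sum => th' _; rewrite inE mulr1.
    case: ifPn => [/forallP th'_b|th'_b].
      rewrite (_ : path th b = path th' b) ?law_path //.
      apply: eq_from_tnth => t; rewrite !tnth_map; congr pair.
      by have /eqP := th'_b t; rewrite tnth_map.
    rewrite law_off //; apply: contraNN th'_b => /eqP path_eq.
    apply/forallP => t; have := congr1 (fun y => (tnth y t).2) path_eq.
    by rewrite !tnth_map /= => ->.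
  rewrite -mulrA ler_pM2l // -natrX -natrM ler_nat.
  by have := card_ffun_through _ _ n b (map_tuple th b); rewrite card_ffun !card_ord.
have term_ge th b : pi b * (#|[pred k | k \in b]|%:R * ln m%:R) <=
    law (src th) (emb (path th b)) *
      ln (law (src th) (emb (path th b)) / r (emb (path th b))).
  have r_gt0 : 0 < r (emb (path th b)).
    apply: divr_gt0; last by rewrite ltr0n.
    rewrite (bigD1 th) //= law_path ltr_wpDr //.
    by apply: sumr_ge0 => th' _; exact: law_ge0.
  rewrite law_path ler_pM2l // mulr_natl -lnXn ?ltr0n //.
  rewrite ler_ln ?posrE ?(divr_gt0 (pi_gt0 b) r_gt0) ?exprn_gt0 ?ltr0n //.
  by rewrite ler_pdivlMr // mulrC r_le.
have information_ge (i : Th) : ln m%:R * \sum_(k < M)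
    ((\sum_(j < M) p j) ^+ n - (\sum_(j < M) p j - p k) ^+ n) <=
    \sum_(x <- s) law (src i) x * ln (law (src i) x / r x).
  rewrite -(sum_occurring_letters _ M n (fun j : 'I_M => p j)) mulr_sumr.
  rewrite big_map (partition_big (fun y => map_tuple fst y) predT) //=.
  apply: ler_sum => b _; rewrite (bigD1 (path i b)) /=; last first.
    by apply/eqP/eq_from_tnth => t; rewrite !tnth_map.
  rewrite [X in _ <= _ + X]big1 => [|y /andP[/eqP <- y_off]]; last first.
    by rewrite law_off // mul0r.
  by rewrite addr0; apply: le_trans (term_ge i b); rewrite mulrCA [ln _ * _]mulrC.
apply: le_trans (minimax_redundancy_ge_information _ _ _ (fun th => @law R (src th) n)
  (laws G n) s Th_gt0 _ _ _ uniq_s); first last.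
- by move=> th; apply: block_source_mass (src_block th) => k; exact: ext_lt.
- by move=> th x; exact: law_ge0.
- by move=> th; exists (src th) => //; apply: G_blocks (src_block th) => k; exact: ext_lt.
rewrite lee_fin [leLHS]mulrAC invfM [leRHS]mulrA.
rewrite ler_pM2r ?invr_gt0 ?ln_gt0 ?ltr1n //.
rewrite ler_pdivlMr ?ltr0n // mulr_natr -sumr_const.
by apply: ler_sum => th _; exact: information_ge.
Qed.

End BlockSources.

Lemma cvg_sum_ord (R : realType) (u : nat -> nat -> R) (l : nat -> R) (K : nat) :
  (forall k, u k @ \oo --> l k) ->
  (\sum_(k < K) u k i) @[i --> \oo] --> (\sum_(k < K) l k : R).
Proof.
move=> u_cvg; elim: K => [|K IH].
  by rewrite big_ord0; under eq_fun do rewrite big_ord0; exact: cvg_cst.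
rewrite big_ord_recr /=; under eq_fun do rewrite big_ord_recr /=.
by apply: cvgD; [exact: IH | exact: u_cvg].
Qed.

(** In [redundancy_ge_blocks] the number of blocks may tend to infinity. *)
Lemma redundancy_ge_occurrences (R : realType) (p : nat -> R) (m n : nat)
    (G : set (source R)) :
  (forall k, 0 < p k) -> (forall k, p k <= 1) -> series p @ \oo --> (1 : R) ->
  (0 < m)%N ->
  (forall th P, (forall k, th k < m)%N -> block_source p m th P -> G P) ->
  ((ln m%:R / ln 2)%:E * \sum_(k <oo) (1 - (1 - p k) ^+ n)%:E
     <= minimax_redundancy (laws G n))%E.
Proof.
move=> p_gt0 p_le1 p_sum1 m_gt0 G_blocks.
have ln2_gt0 : 0 < ln (2 : R) by rewrite ln_gt0 // ltr1n.
set c := ln m%:R / ln 2.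
have c_ge0 : 0 <= c by rewrite divr_ge0 ?ln_ge0 ?ler1n ?(ltW ln2_gt0).
have term_ge0 k : (0 <= (1 - (1 - p k) ^+ n)%:E)%E.
  rewrite lee_fin subr_ge0 exprn_ile1 ?subr_ge0 ?p_le1 // gerBl.
  exact: ltW.
rewrite -nneseriesZl //; apply: lime_le.
  apply: is_cvg_nneseries => k _ _; apply: mule_ge0 => //.
near=> K; rewrite /= big_mkord.
under eq_bigr do rewrite -EFinM.
rewrite sumEFin -mulr_sumr.
set S := minimax_redundancy _.
have S_ge M : ((c * \sum_(k < M) ((\sum_(j < M) p j) ^+ n -
    (\sum_(j < M) p j - p k) ^+ n))%:E <= S)%E.
  exact: redundancy_ge_blocks.
have : S != -oo%E by rewrite gt_eqF // (lt_le_trans _ (S_ge 0%N)) // ltNyr.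
case: S S_ge => [v| |] // S_ge _; last by rewrite leey.
have lim_K : c * \sum_(k < K) ((series p M) ^+ n - (series p M - p k) ^+ n)
    @[M --> \oo] --> c * \sum_(k < K) (1 - (1 - p k) ^+ n).
  apply: cvgM; first exact: cvg_cst.
  apply: (cvg_sum_ord _ (fun k M => (series p M) ^+ n - (series p M - p k) ^+ n)
    (fun k => 1 - (1 - p k) ^+ n)) => k.
  rewrite -[X in _ --> X - _](expr1n R n).
  apply: cvgB; first exact: cvg_expn.
  by apply: cvg_expn; apply: cvgB => //; exact: cvg_cst.
rewrite lee_fin -(cvg_lim _ lim_K) //; apply: limr_le; first exact: cvgP lim_K.
near=> M.
have KM : (K <= M)%N by near: M; exact: nbhs_infty_ge.
apply: le_trans (_ : c * \sum_(k < M) ((\sum_(j < M) p j) ^+ n -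
    (\sum_(j < M) p j - p k) ^+ n) <= _); last by rewrite -lee_fin.
rewrite ler_wpM2l // /series /= big_mkord.
pose f k := (\sum_(j < M) p j) ^+ n - (\sum_(j < M) p j - p k) ^+ n.
rewrite -!(big_mkord xpredT f) (big_cat_nat (leq0n K) KM) /= lerDl.
rewrite big_nat_cond sumr_ge0 // => k /andP[/andP[_ kM] _].
have le_sum : p k <= \sum_(j < M) p j.
  rewrite (bigD1 (Ordinal kM)) //= lerDl sumr_ge0 // => j _; exact: ltW.
rewrite subr_ge0 lerXn2r ?nnegrE ?subr_ge0 ?sumr_ge0 //.
  by move=> j _; exact: ltW.
by rewrite gerBl ltW.
Unshelve. all: by end_near. Qed.

(** * Comparison with the integral *)

Section RedundancyConstant.
Context {R : realType}.
Local Notation mu := (@lebesgue_measure R).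

Lemma continuous_powR (a x : R) : 0 < x -> {for x, continuous (@powR R ^~ a)}.
Proof.
move=> x_gt0; apply: differentiable_continuous; apply/derivable1_diffP.
by apply: derivable_powR; rewrite in_itv /= andbT.
Qed.

Lemma integral_powR (c x y : R) : 0 < x -> x < y ->
  (\int[mu]_(u in `[x, y[) (c * u `^ (c - 1))%:E = (y `^ c - x `^ c)%:E)%E.
Proof.
move=> x_gt0 x_lt_y.
have meas : measurable_fun [set: R] (fun u : R => c * u `^ (c - 1)).
  by apply: measurable_funM => //; exact: measurable_powR.
rewrite integral_itv_bndo_bndc; last first.
  exact/measurable_EFinP/measurable_funTS.
have y_gt0 := lt_trans x_gt0 x_lt_y.
rewrite (@continuous_FTC2 _ _ (@powR R ^~ c)) //.
- apply: continuous_in_subspaceT => u; rewrite inE /= in_itv /= => /andP[x_le _].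
  apply: cvgM; first exact: cvg_cst.
  by apply: continuous_powR; apply: lt_le_trans x_le.
- split.
  + move=> u; rewrite in_itv /= => /andP[x_lt _].
    by apply: derivable_powR; rewrite in_itv /= andbT (lt_trans x_gt0).
  + by apply: cvg_at_right_filter; exact: continuous_powR.
  + by apply: cvg_at_left_filter; exact: continuous_powR.
- move=> u; rewrite in_itv /= => /andP[x_lt _].
  by rewrite powR_derive1 // in_itv /= andbT (lt_trans x_gt0).
Qed.

Variable alpha : R.
Hypothesis alpha_gt1 : 1 < alpha.

Let alpha_gt0 : 0 < alpha. Proof. exact: lt_trans ltr01 _. Qed.

Lemma zeta_cvg :
  series (fun k : nat => (k.+1%:R `^ alpha)^-1) @ \oo --> zeta alpha.
Proof.
apply: nondecreasing_is_cvgn.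
  apply/nondecreasing_seqP => k; rewrite /series /= big_nat_recr //= lerDl.
  by rewrite invr_ge0 powR_ge0.
exists (1 + (alpha - 1)^-1) => _ [k _ <-]; rewrite /series /= big_mkord.
apply: le_trans (_ : \sum_(j < k.+1) (j.+1%:R `^ alpha)^-1 <= _).
  by rewrite big_ord_recr /= lerDl invr_ge0 powR_ge0.
rewrite big_ord_recl /= powR1 invr1 lerD2l.
under eq_bigr do rewrite -powRN /bump.
have := @sum_powR_tail_le R alpha alpha_gt1 1 k isT.
by rewrite powR1 mul1r.
Qed.

Lemma zeta_ge1 : 1 <= zeta alpha.
Proof.
have nd : nondecreasing_seq (series (fun k : nat => (k.+1%:R `^ alpha)^-1 : R)).
  apply/nondecreasing_seqP => k; rewrite /series /= big_nat_recr //= lerDl.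
  by rewrite invr_ge0 powR_ge0.
apply: le_trans (nondecreasing_cvgn_le nd (cvgP _ zeta_cvg) 1%N).
by rewrite /series /= big_nat1 powR1 invr1.
Qed.

Definition zeta_mass (k : nat) : R := (zeta alpha * k.+1%:R `^ alpha)^-1.

Let zeta_gt0 : 0 < zeta alpha. Proof. exact: lt_le_trans zeta_ge1. Qed.

Lemma zeta_mass_gt0 k : 0 < zeta_mass k.
Proof. by rewrite invr_gt0 mulr_gt0 ?powR_gt0. Qed.

Lemma zeta_mass_le1 k : zeta_mass k <= 1.
Proof.
rewrite invf_le1 ?mulr_gt0 ?powR_gt0 //; apply: mulr_ege1; first exact: zeta_ge1.
rewrite -[leLHS](powRr0 k.+1%:R); apply: ler_powR; last exact: ltW.
by rewrite ler1n.
Qed.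

Lemma zeta_mass_sum1 : series zeta_mass @ \oo --> (1 : R).
Proof.
rewrite -(mulVf (lt0r_neq0 zeta_gt0)).
have -> : series zeta_mass =
    (fun k => (zeta alpha)^-1 * series (fun k => (k.+1%:R `^ alpha)^-1) k).
  apply/funext => k; rewrite /series /= mulr_sumr; apply: eq_bigr => j _.
  by rewrite /zeta_mass invfM.
by apply: cvgM; [exact: cvg_cst | exact: zeta_cvg].
Qed.

Variable n : nat.
Hypothesis n_gt0 : (0 < n)%N.

Let c := alpha^-1.
Let c_gt0 : 0 < c. Proof. by rewrite invr_gt0. Qed.
Let nR_gt0 : 0 < n%:R :> R. Proof. by rewrite ltr0n. Qed.

(* The substitution u = x `^ alpha / n turns [k + 1, k + 2) into the interval
   between two consecutive values of [cut]. *)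
Let cut (k : nat) : R := k.+1%:R `^ alpha / n%:R.

Let cut_gt0 k : 0 < cut k. Proof. by rewrite divr_gt0 ?powR_gt0. Qed.

Let cutS k : cut k < cut k.+1.
Proof.
rewrite /cut ltr_pM2r ?invr_gt0 // gt0_ltr_powR ?nnegrE //.
by rewrite ltr_nat.
Qed.

Let cut_pow k : cut k `^ c = k.+1%:R / n%:R `^ c.
Proof. by rewrite powR_div ?powR_ge0 // -powRrM divff ?gt_eqF // powRr1. Qed.

(* The integrand of [redundancy_constant], scaled by [n `^ alpha^-1 / alpha]. *)
Let kernel (u : R) : R :=
  n%:R `^ c * (c * u `^ (c - 1)) * (1 - expR (- ((zeta alpha)^-1 * u `^ (-1)))).

Let kernel_meas : measurable_fun [set: R] (EFin \o kernel).
Proof.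
apply/measurable_EFinP; apply: measurable_funM.
  by do 2! apply: measurable_funM => //; exact: measurable_powR.
apply: measurable_funB => //; apply: measurableT_comp => //.
by apply: measurableT_comp => //; apply: measurable_funM.
Qed.

Let kernel_ge0 u : 0 <= kernel u.
Proof.
rewrite mulr_ge0 ?mulr_ge0 ?powR_ge0 ?(ltW c_gt0) // subr_ge0 -expR0 ler_expR.
by rewrite oppr_le0 mulr_ge0 ?powR_ge0 // invr_ge0 ltW.
Qed.

Let constantE : ((n%:R `^ c)%:E * redundancy_constant alpha =
  \int[mu]_(u in `[1%R, +oo[) (EFin \o kernel) u)%E.
Proof.
have K_ge0 : (0 <= (n%:R `^ c * c)%:E)%E.
  by rewrite lee_fin mulr_ge0 ?powR_ge0 // ltW.
rewrite /redundancy_constant muleA -EFinM.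
pose h (u : R) := u `^ (c - 1) * (1 - expR (- ((zeta alpha)^-1 * u `^ (-1)))).
have h_meas : measurable_fun (`[1, +oo[%classic : set R) (EFin \o h).
  apply/measurable_EFinP/measurable_funTS; apply: measurable_funM => //.
  apply: measurable_funB => //; apply: measurableT_comp => //.
  by apply: measurableT_comp => //; apply: measurable_funM.
have h_ge0 u : (0 <= (EFin \o h) u)%E.
  rewrite lee_fin mulr_ge0 ?powR_ge0 // subr_ge0 -expR0 ler_expR.
  by rewrite oppr_le0 mulr_ge0 ?powR_ge0 // invr_ge0 ltW.
rewrite (_ : (\int[_]_(u in _) _)%E = (\int[mu]_(u in `[1%R, +oo[) (EFin \o h) u)%E).
  rewrite -ge0_integralZl //; apply: eq_integral => u _ /=.
  by rewrite -EFinM /kernel /h -/c; congr EFin; ring.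
apply: eq_integral => u; rewrite inE /= in_itv /= andbT => u_ge1.
have u_gt0 : 0 < u by apply: lt_le_trans u_ge1.
by rewrite /h -powRN opprB invfM powR_inv1 // ltW.
Qed.

Let kernel_cut k :
  (\int[mu]_(u in `[cut k, cut k.+1[) (EFin \o kernel) u <=
     (1 - expR (- (n%:R * zeta_mass k)))%:E)%E.
Proof.
pose w := 1 - expR (- (n%:R * zeta_mass k)).
have w_ge0 : 0 <= w.
  rewrite subr_ge0 -expR0 ler_expR oppr_le0 mulr_ge0 // ltW //.
  exact: zeta_mass_gt0.
pose g (u : R) := c * u `^ (c - 1).
have g_meas : measurable_fun (`[cut k, cut k.+1[%classic : set R) (EFin \o g).
  by apply/measurable_EFinP/measurable_funTS; apply: measurable_funM.
have g_ge0 u : (0 <= (EFin \o g) u)%E.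
  by rewrite lee_fin mulr_ge0 ?powR_ge0 // ltW.
have K_ge0 : (0 <= (n%:R `^ c * w)%:E)%E by rewrite lee_fin mulr_ge0 ?powR_ge0.
apply: le_trans (_ : \int[mu]_(u in `[cut k, cut k.+1[)
    ((n%:R `^ c * w)%:E * (EFin \o g) u) <= _)%E.
  apply: ge0_le_integral => //.
  - by move=> u _; rewrite /= lee_fin kernel_ge0.
  - exact: measurable_funTS.
  - by apply: measurable_funeM.
  - move=> u; rewrite /= in_itv /= => /andP[cut_le _].
    have u_gt0 : 0 < u by apply: lt_le_trans cut_le.
    rewrite -EFinM lee_fin /kernel -/(g u) [leRHS]mulrAC.
    have := g_ge0 u; rewrite lee_fin => gu_ge0.
    rewrite ler_wpM2l ?(mulr_ge0 (powR_ge0 _ _) gu_ge0) //.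
    rewrite /w lerD2l lerN2 ler_expR lerN2 powR_inv1 ?(ltW u_gt0) //.
    have -> : n%:R * zeta_mass k = (zeta alpha * cut k)^-1.
      by rewrite /cut /zeta_mass mulrA invf_div.
    by rewrite -invfM lef_pV2 ?posrE ?(mulr_gt0 zeta_gt0) // ler_pM2l.
rewrite ge0_integralZl // integral_powR // -EFinM lee_fin !cut_pow.
rewrite -mulrBl -natrB // subSn // subnn mul1r mulrAC divff ?mul1r //.
by rewrite gt_eqF // powR_gt0.
Qed.

(** Between two cuts the exponential factor of the integrand is at most its value
    at the left end, where it equals [1 - expR (- (n * zeta_mass k))], and the
    remaining factor integrates to 1. *)
Lemma redundancy_constant_le :
  ((n%:R `^ alpha^-1)%:E * redundancy_constant alpha <=
     \sum_(k <oo) (1 - (1 - zeta_mass k) ^+ n)%:E)%E.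
Proof.
rewrite -/c constantE.
pose E k : set R := `[cut k, cut k.+1[%classic.
have cut_le j k : (j <= k)%N -> cut j <= cut k.
  move=> /subnK <-; elim: (k - j)%N => [//|i IH].
  by rewrite addSn (le_trans IH) // ltW.
have mE k : measurable (E k) by exact: measurable_itv.
have trivE : trivIset [set: nat] E.
  have Ele i j u : E i u -> E j u -> (i <= j)%N.
    rewrite /E /= !in_itv /= => /andP[i_le _] /andP[_ j_lt].
    rewrite leqNgt; apply/negP => /cut_le ji.
    by have := lt_le_trans j_lt (le_trans ji i_le); rewrite ltxx.
  move=> i j _ _ [u [Ei Ej]].
  by apply/eqP; rewrite eqn_leq (Ele i j u) // (Ele j i u).
have coverE : `[1, +oo[%classic `<=` \bigcup_k E k.
  move=> u; rewrite /= in_itv /= andbT => u_ge1.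
  have u_gt0 : 0 < u by apply: lt_le_trans u_ge1.
  pose v := (n%:R * u) `^ c.
  have v_ge1 : 1 <= v.
    rewrite [leLHS](_ : _ = 1 `^ c); last by rewrite powR1.
    rewrite ge0_ler_powR ?nnegrE ?mulr_ge0 ?(ltW c_gt0) ?(ltW u_gt0) //.
    by apply: mulr_ege1 => //; rewrite ler1n.
  have v_ge0 : 0 <= v by exact: powR_ge0.
  have vE : v `^ alpha = n%:R * u.
    by rewrite -powRrM mulVf ?gt_eqF // powRr1 // mulr_ge0 // ltW.
  have /andP[v_ge v_lt] := truncn_itv v_ge0.
  have [k truncE] : exists k, Num.truncn v = k.+1.
    case: (Num.truncn v) v_lt => [|k _]; last by exists k.
    by rewrite ltNge v_ge1.
  exists k => //; rewrite /E /= in_itv /= /cut.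
  rewrite ler_pdivrMr // ltr_pdivlMr // mulrC -vE -truncE.
  rewrite ge0_ler_powR ?nnegrE ?(ltW alpha_gt0) //=.
  by rewrite gt0_ltr_powR ?nnegrE.
apply: le_trans (_ : \int[mu]_(u in \bigcup_k E k) (EFin \o kernel) u <= _)%E.
  apply: ge0_subset_integral => //.
  - exact: bigcupT_measurable.
  - exact: measurable_funTS.
  - by move=> u _; rewrite /= lee_fin kernel_ge0.
rewrite ge0_integral_bigcup //; first last.
- by move=> u _; rewrite /= lee_fin kernel_ge0.
- exact: measurable_funTS.
apply: lee_nneseries => [k _ _|k _].
  by apply: integral_ge0 => u _; rewrite /= lee_fin kernel_ge0.
apply: le_trans (kernel_cut k) _; rewrite lee_fin lerD2l lerN2.
rewrite -mulrN expRM_natl lerXn2r ?nnegrE ?expR_ge0 ?subr_ge0 ?zeta_mass_le1 //.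
exact: expR_ge1Dx.
Qed.

End RedundancyConstant.

(** * The two bounds *)

Section EnvelopeBlocks.
Context {R : realType}.
Variables (alpha C : R) (m : nat).
Hypotheses (alpha_gt1 : 1 < alpha) (C_gt1 : 1 < C) (m_gt0 : (0 < m)%N).
Hypothesis m_le : m%:R `^ alpha <= C * zeta alpha.

Lemma block_source_marginal (p : nat -> R) th (P : source R) k :
  block_source p m th P -> marginal P (block_letter m th k) = p k.
Proof.
move=> [P_law _]; rewrite /marginal.
rewrite (_ : [tuple _] = map_tuple (block_letter m th) [tuple k]).
  by rewrite P_law big_ord1 tnth0.
exact/val_inj.
Qed.

(** The letter selected in block [k] is at most [m * k.+1], so its envelope is at
    least [C / (m * k.+1) `^ alpha >= 1 / (zeta alpha * k.+1 `^ alpha)]. *)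
Lemma block_source_envelope th (P : source R) : (forall k, th k < m)%N ->
  block_source (zeta_mass alpha) m th P ->
  envelope_class (power_envelope alpha C) P.
Proof.
move=> th_lt P_block; have [P_law P_off] := P_block.
have marginal_off a : (forall k, a <> block_letter m th k) -> marginal P a = 0.
  by move=> a_off; apply: (P_off 1%N _ ord0) => k; rewrite tnth0; exact: a_off.
split=> [n x|a].
  have [x_on|/existsNP[t x_off]] := pselect
      (forall t, exists k, tnth x t = block_letter m th k); last first.
    have {}x_off k : tnth x t <> block_letter m th k by move=> xk; apply: x_off; exists k.
    by rewrite (P_off _ _ t) // (bigD1 t) //= marginal_off ?mul0r.
  have [b bE] := fin_all_exists x_on.
  rewrite (_ : x = map_tuple (block_letter m th) [tuple b t | t < n]); last first.
    by apply: eq_from_tnth => t; rewrite tnth_map tnth_mktuple.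
  rewrite P_law; apply: eq_bigr => t _.
  by rewrite [in RHS]tnth_map (block_source_marginal _ _ _ _ P_block).
have [[k ->]|a_off] := pselect (exists k, a = block_letter m th k); last first.
  rewrite marginal_off => [|k ak]; last by apply: a_off; exists k.
  by rewrite ltW // power_envelope_gt0.
rewrite (block_source_marginal _ _ _ _ P_block) /power_envelope le_min.
rewrite zeta_mass_le1 //= ler_pdivlMr ?powR_gt0 ?ltr0n //.
have zeta_gt0 : 0 < zeta alpha by apply: lt_le_trans (zeta_ge1 _ alpha_gt1).
rewrite mulrC ler_pdivrMr ?mulr_gt0 ?powR_gt0 //.
rewrite mulrA; apply: le_trans (_ : (m%:R * k.+1%:R) `^ alpha <= _).
  rewrite ge0_ler_powR ?nnegrE ?(ltW (lt_trans ltr01 alpha_gt1)) //.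
  by rewrite -natrM ler_nat mulnS mulnC addnC ltn_add2r.
by rewrite powRM // ler_wpM2r ?powR_ge0.
Qed.

End EnvelopeBlocks.

Theorem theorem6 (R : realType) (alpha C : R)
    (alpha_gt1 : 1 < alpha) (C_gt1 : 1 < C)
    (C_zeta : 2 `^ alpha <= C * zeta alpha) :
  (forall n : nat, (0 < n)%N ->
    ((n%:R `^ alpha^-1)%:E * redundancy_constant alpha *
       (log2 (Num.floor ((C * zeta alpha) `^ alpha^-1))%:~R)%:E
     <= minimax_redundancy (laws (envelope_class (power_envelope alpha C)) n))%E)
  /\
  (exists K : R, \forall n \near \oo,
    (minimax_regret (laws (envelope_class (power_envelope alpha C)) n)
     <= ((2 * C * n%:R / (alpha - 1)) `^ alpha^-1
           * (log2 n%:R) `^ (1 - alpha^-1) + K)%:E)%E).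
Proof.
split=> [n n_gt0|]; last first.
  by exists 0; apply: filterS (power_regret_near _ _ alpha_gt1 C_gt1) => n; rewrite addr0.
have alpha_gt0 : 0 < alpha := lt_trans ltr01 alpha_gt1.
have Cz_ge0 : 0 <= C * zeta alpha by apply: le_trans C_zeta; rewrite powR_ge0.
set y := (C * zeta alpha) `^ alpha^-1.
have y_ge2 : 2 <= y.
  rewrite [leLHS](_ : 2 = (2 `^ alpha) `^ alpha^-1); last first.
    by rewrite -powRrM mulfV ?powRr1 // gt_eqF.
  by rewrite ge0_ler_powR ?nnegrE ?powR_ge0 ?invr_ge0 ?(ltW alpha_gt0).
have y_alpha : y `^ alpha = C * zeta alpha.
  by rewrite /y -powRrM mulVf ?powRr1 // gt_eqF.
pose m := `|Num.floor y|%N.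
have floorE : (Num.floor y)%:~R = m%:R :> R.
  have : 0 <= Num.floor y by rewrite floor_ge0 (le_trans _ y_ge2).
  by rewrite natr_absz => /ger0_norm ->.
have m_le : m%:R <= y by rewrite -floorE floor_le.
have m_gt0 : (0 < m)%N.
  by rewrite absz_gt0 gt_eqF // floor_gt0 (le_trans _ y_ge2) // ler1n.
rewrite floorE /log2 muleC.
have m_alpha : m%:R `^ alpha <= C * zeta alpha.
  by rewrite -y_alpha ge0_ler_powR ?nnegrE ?(ltW alpha_gt0) ?powR_ge0.
apply: le_trans (redundancy_ge_occurrences _ (zeta_mass alpha) m n _
  (zeta_mass_gt0 _ alpha_gt1) (zeta_mass_le1 _ alpha_gt1)
  (zeta_mass_sum1 _ alpha_gt1) m_gt0 _); last first.
  by move=> th P; exact: block_source_envelope.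
rewrite lee_wpmul2l ?redundancy_constant_le // lee_fin divr_ge0 ?ln_ge0 ?ler1n //.
Qed.
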